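(* Let $2\leq n<\omega$. If $\mathfrak{A}\in PTA_n$, then $\mathfrak{A}\in \mathbf{I}D_n$; that is, every partial transposition algebra of dimension $n$ is isomorphic to an algebra in $D_n$.
   Context: Let $\alpha$ be an ordinal. **Abstract algebras.** $PTA_\alpha$ (partial transposition algebras of dimension $\alpha$) is the class of algebras $\mathfrak{A}=\langle A,+,\cdot,-,0,1,c_i,d_{ij}\rangle_{i,j\in\alpha}$ ($+,\cdot$ binary, $-,c_i$ unary, $0,1,d_{ij}$ constants) satisfying, for all $i,j,k,m\in\alpha$ and all $x$: - $(C_0)$-$(C_3)$: $\langle A,+,\cdot,-,0,1,c_i\rangle_{i\in\alpha}$ is a Boolean algebra with additive closure operators $c_i$ such that the complements of $c_i$-closed elements are $c_i$-closed; - $(C_4)^*$: $c_ic_jx\geq c_jc_ix\cdot d_{jk}$ if $k\notin\{i,j\}$; - $(C_5)$: $d_{ii}=1$; - $(C_6)$: $d_{ij}=c_k(d_{ik}\cdot d_{kj})$ if $k\notin\{i,j\}$; - $(C_7)$: $d_{ij}\cdot c_i(d_{ij}\cdot x)\leq x$ if $i\neq j$; - (MGR): putting $s^i_jx=c_i(d_{ij}\cdot x)$ for $i\neq j$ and $s^i_ix=x$, one has $s^k_is^i_js^j_ms^m_kc_kx=s^k_ms^m_is^i_js^j_kc_kx$ if $k\notin\{i,j,m\}$ and $m\notin\{i,j\}$. **Concrete algebras.** For an $\alpha$-termed sequence $y$, $y^i_u$ is the sequence agreeing with $y$ except that its $i$th term is $u$. For a set $V$ of $\alpha$-termed sequences,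 $X\subseteq V$ and $i,j<\alpha$, let $C_i^VX=\{y\in V: y^i_u\in X\text{ for some }u\}$ and $D^V_{ij}=\{y\in V:y_i=y_j\}$. $Crs_\alpha$ is the class of algebras $\langle \mathsf{A},\cup,\cap,\sim_V,\emptyset,V,C^V_i,D^V_{ij}\rangle_{i,j<\alpha}$ where $V$ is a set of $\alpha$-termed sequences (the unit), $\sim_V$ is complement relative to $V$, and $\mathsf{A}$ is a non-empty set of subsets of $V$ closed under $\cup,\cap,\sim_V$ and all $C^V_i$, and containing $\emptyset$, $V$ and all $D^V_{ij}$. $D_\alpha$ is the subclass of those members of $Crs_\alpha$ whose unit $V$ satisfies $C^V_i(D^V_{ij}\cap V)=V$ for all $i,j<\alpha$. For a class $K$ of algebras, $\mathbf{I}K$ is the class of all algebras isomorphic to members of $K$. *)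

(* Defs.v *)
From mathcomp Require Import all_boot.
From mathcomp Require Import boolp classical_sets.

Set Implicit Arguments.
Unset Strict Implicit.
Unset Printing Implicit Defensive.

Declare Scope alg_scope.
Delimit Scope alg_scope with A.

(* Algebras of cylindric type, with the dimension given by an index type I;
   no axioms are imposed. *)
Record algebra (I : Type) := Algebra {
  carrier :> Type;
  add : carrier -> carrier -> carrier;
  mul : carrier -> carrier -> carrier;
  opp : carrier -> carrier;
  zero : carrier;
  one : carrier;
  cyl : I -> carrier -> carrier;
  diag : I -> I -> carrier
}.

Arguments add {I a}.
Arguments mul {I a}.
Arguments opp {I a}.
Arguments zero {I a}.
Arguments one {I a}.
Arguments cyl {I a}.
Arguments diag {I a}.

Notation "x + y" := (add x y) : alg_scope.
Notation "x * y" := (mul x y) : alg_scope.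
Notation "- x" := (opp x) : alg_scope.
Notation "0" := zero : alg_scope.
Notation "1" := one : alg_scope.

Definition le (I : Type) (A : algebra I) (x y : A) : Prop := (x * y)%A = x.

Notation "x <= y" := (le x y) : alg_scope.

Record boolean_algebra (I : Type) (A : algebra I) : Prop := BooleanAlgebra {
  add_assoc : associative (@add I A);
  mul_assoc : associative (@mul I A);
  add_comm : commutative (@add I A);
  mul_comm : commutative (@mul I A);
  add_absorb : forall x y : A, (x + x * y)%A = x;
  mul_absorb : forall x y : A, (x * (x + y))%A = x;
  mul_add_distr : left_distributive (@mul I A) (@add I A);
  add_mul_distr : left_distributive (@add I A) (@mul I A);
  add_zero : left_id 0%A (@add I A);
  mul_one : left_id 1%A (@mul I A);
  add_opp : forall x : A, (x + - x)%A = 1%A;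
  mul_opp : forall x : A, (x * - x)%A = 0%A
}.

Record additive_closure (I : Type) (A : algebra I) (c : A -> A) : Prop :=
  AdditiveClosure {
  closure_ext : forall x, (x <= c x)%A;
  closure_mono : forall x y, (x <= y)%A -> (c x <= c y)%A;
  closure_idem : forall x, c (c x) = c x;
  closure_add : forall x y, c (x + y)%A = (c x + c y)%A
}.

(* sub i j x is the substitution s^i_j x. *)
Definition sub (I : eqType) (A : algebra I) (i j : I) (x : A) : A :=
  if i == j then x else cyl i (diag i j * x)%A.

Record PTA (I : eqType) (A : algebra I) : Prop := IsPTA {
  pta_boolean : boolean_algebra A;
  pta_closure : forall i, additive_closure (@cyl I A i);
  pta_compl : forall i (x : A), cyl i x = x -> cyl i (- x)%A = (- x)%A;
  pta_C4 : forall i j k (x : A), k \notin [:: i; j] ->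
    (cyl j (cyl i x) * diag j k <= cyl i (cyl j x))%A;
  pta_C5 : forall i, diag i i = 1%A :> A;
  pta_C6 : forall i j k, k \notin [:: i; j] ->
    diag i j = cyl k (diag i k * diag k j)%A :> A;
  pta_C7 : forall i j (x : A), i != j ->
    (diag i j * cyl i (diag i j * x) <= x)%A;
  pta_MGR : forall i j k m (x : A), k \notin [:: i; j; m] ->
    m \notin [:: i; j] ->
    sub k i (sub i j (sub j m (sub m k (cyl k x))))
      = sub k m (sub m i (sub i j (sub j k (cyl k x))))
}.

Local Open Scope classical_set_scope.

(* [eta y with i |-> u] is the sequence y with its i-th term replaced by u. *)
Definition cylset (I : eqType) (U : Type) (V : set (I -> U)) (i : I)
    (X : set (I -> U)) : set (I -> U) :=
  [set y | V y /\ exists u : U, X [eta y with i |-> u]].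

Definition diagset (I : eqType) (U : Type) (V : set (I -> U)) (i j : I) :
    set (I -> U) :=
  [set y | V y /\ y i = y j].

Record set_algebra (I : eqType) := SetAlgebra {
  base : Type;
  unit_set : set (I -> base);
  members : set (set (I -> base));
  members_sub : forall X, members X -> X `<=` unit_set;
  members0 : members set0;
  members1 : members unit_set;
  membersU : forall X Y, members X -> members Y -> members (X `|` Y);
  membersI : forall X Y, members X -> members Y -> members (X `&` Y);
  membersC : forall X, members X -> members (unit_set `\` X);
  members_cyl : forall i X, members X -> members (cylset unit_set i X);
  members_diag : forall i j, members (diagset unit_set i j)
}.

Arguments unit_set {I} s _.
Arguments members {I} s _.

Definition algebra_of (I : eqType) (S : set_algebra I) : algebra I :=
  @Algebra I {X : set (I -> base S) | members S X}
    (fun X Y => exist _ _ (membersU (proj2_sig X) (proj2_sig Y)))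
    (fun X Y => exist _ _ (membersI (proj2_sig X) (proj2_sig Y)))
    (fun X => exist _ _ (membersC (proj2_sig X)))
    (exist _ _ (members0 S))
    (exist _ _ (members1 S))
    (fun i X => exist _ _ (members_cyl i (proj2_sig X)))
    (fun i j => exist _ _ (members_diag S i j)).

Definition Crs (I : eqType) (B : algebra I) : Prop :=
  exists S : set_algebra I, B = algebra_of S.

Definition D (I : eqType) (B : algebra I) : Prop :=
  exists S : set_algebra I,
    (forall i j, cylset (unit_set S) i
                   (diagset (unit_set S) i j `&` unit_set S) = unit_set S) /\
    B = algebra_of S.

Record homomorphism (I : Type) (A B : algebra I) (f : A -> B) : Prop :=
  Homomorphism {
  hom_add : forall x y, f (x + y)%A = (f x + f y)%A;
  hom_mul : forall x y, f (x * y)%A = (f x * f y)%A;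
  hom_opp : forall x, f (- x)%A = (- f x)%A;
  hom_zero : f 0%A = 0%A;
  hom_one : f 1%A = 1%A;
  hom_cyl : forall i x, f (cyl i x) = cyl i (f x);
  hom_diag : forall i j, f (diag i j) = diag i j
}.

Definition isomorphic (I : Type) (A B : algebra I) : Prop :=
  exists f : A -> B, homomorphism f /\ bijective f.

Definition iso_closure (I : Type) (K : algebra I -> Prop) (A : algebra I) :
    Prop :=
  exists B : algebra I, K B /\ isomorphic A B.

(* Main.v *)
Require Import Defs.
From mathcomp Require Import all_boot.
From mathcomp Require Import boolp classical_sets.

Set Implicit Arguments.
Unset Strict Implicit.
Unset Printing Implicit Defensive.

(** The substitutions s^i_j (i <> j) are Boolean endomorphisms, so each of them
    pulls an ultrafilter a back to an ultrafilter a.{i := j}, to be read as: copy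
    the j-th term of a onto its i-th term. Ultrafilters and these copies form a
    purely algebraic structure, a [subst_system], which determines everything
    else: d_ij belongs to a exactly when a.{i := j} = a, and c_i x belongs to a
    exactly when x belongs to some b with a.{i := j} = b.{i := j} for the j <> i.
    The algebra is therefore represented as soon as there is a set of sequences,
    labelled by ultrafilters, such that labels commute with copies, y_i = y_j
    exactly when the label of y contains d_ij, and every b as above is the label
    of some y^i_u.

    Such a set is built freely: start with one sequence for each ultrafilter, add
    a brand-new value for each one-coordinate change of label, and close under
    copies ([label]). The only danger is that one sequence gets two labels. A
    labelled sequence comes from a sequence containing its newest value by a word
    of copies, so this reduces to the question whether two words of copies
    inducing the same map on indices act equally on every system of points
    ([word_problem], [run_equal_at], [label_unique]).

    The answer amounts to a presentation of the semigroup of singular self-maps of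
    a finite set, generated by the idempotents i |-> j, and it is where the
    merry-go-round identities enter. A copy destroys a value, so the target
    coordinate x becomes a hole through which two other coordinates i and j can be
    exchanged by x := i, i := j, j := x. The merry-go-round identities for two
    and for three indices say that these exchanges behave like transpositions up
    to the content of the hole ([swapC], [swap_rotate]); the commutation of
    disjoint exchanges follows by moving the hole ([swap_disjoint]). Hence two
    lists of exchanges with the same effect can be sorted into the same form
    ([peel_swap], [swaps_determined]). An arbitrary word whose map is not injective
    may be followed by a collapse c of the kernel of that map onto representatives
    and may start by overwriting a coordinate x outside its range; between these
    two ends it only permutes the values that survive, so it can be replaced by
    exchanges ([sort_injective]). *)

(** * Copying coordinates *)

(** The model is a set of sequences y, with [copy i j y] the sequence whose i-th
    term is replaced by y_j. [copy_reflect] reflects that c_i d_kl = d_kl;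
    [copy_mgr] is the merry-go-round identity, in which the last copy onto k
    erases the arbitrary value left at k by both sides. *)
Record subst_system (I : eqType) := SubstSystem {
  point :> Type;
  copy : I -> I -> point -> point;
  copy_id : forall i a, copy i i a = a;
  copy_over : forall i j k a, k != i -> copy i k (copy i j a) = copy i k a;
  copy_comm : forall i j k l a, k != i -> l != i -> j != k ->
    copy k l (copy i j a) = copy i j (copy k l a);
  copy_reflect : forall i j k l a, k != i -> l != i ->
    copy k l (copy i j a) = copy i j a -> copy k l a = a;
  copy_alias : forall i j k a, copy i j (copy j k a) = copy i k (copy j k a);
  copy_mgr : forall k i j m l a, k \notin [:: i; j; m] -> m \notin [:: i; j] ->
    l != k ->
    copy k l (copy m k (copy j m (copy i j (copy k i a))))
      = copy k l (copy j k (copy i j (copy m i (copy k m a))))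
}.

Notation "a .{ i := j }" := (copy i j a)
  (at level 2, left associativity, format "a .{ i  :=  j }").

Section Points.
Variables (I : eqType) (S : subst_system I).
Implicit Types (a b : S) (i j k l x : I).

(** In a set of sequences this says that a and b differ at most in the x-th
    term; by [copy_over] a single j <> x decides it ([agree_off_one]). On
    ultrafilters it is the accessibility relation of c_x, provided that there are
    at least two indices. *)
Definition agree_off x a b := forall j, j != x -> a.{x := j} = b.{x := j}.

Lemma agree_off_sym x a b : agree_off x a b -> agree_off x b a.
Proof. by move=> h j jx; rewrite h. Qed.

Lemma agree_off_trans x b a c :
  agree_off x a b -> agree_off x b c -> agree_off x a c.
Proof. by move=> h1 h2 j jx; rewrite h1 ?h2. Qed.

Lemma copy_agree i j a : agree_off i a.{i := j} a.
Proof. by move=> k ki; rewrite copy_over. Qed.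

Lemma agree_off_one i j a b : j != i -> a.{i := j} = b.{i := j} ->
  agree_off i a b.
Proof. by move=> ji h k ki; rewrite -(copy_over j a ki) h copy_over. Qed.

Lemma copy_sym i j a : a.{i := j}.{j := i} = a.{i := j}.
Proof. by rewrite copy_alias copy_id. Qed.

Lemma copy_idem i j a : a.{i := j}.{i := j} = a.{i := j}.
Proof.
by case: (eqVneq j i) => [->|ji]; rewrite ?copy_id // copy_over.
Qed.

(** A copy not involving x cannot see the x-th term. For the coordinate i itself
    the term read back at x is aliased to j, since i and j now agree. *)
Lemma agree_off_copy x i j a b : i != x -> j != x ->
  agree_off x a b -> agree_off x a.{i := j} b.{i := j}.
Proof.
move=> ix jx h k kx.
case: (eqVneq k i) => [->|ki].
  case: (eqVneq i j) => [->|ij]; first by rewrite !copy_id h.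
  have E c : c.{i := j}.{x := i} = c.{x := j}.{i := j}.
    by rewrite copy_alias copy_comm // eq_sym.
  by rewrite !E h.
by rewrite -!(@copy_comm _ S x k i j) 1?h // eq_sym.
Qed.

Definition equal_at a i j := a.{i := j} = a.

Lemma equal_at_refl a i : equal_at a i i.
Proof. exact: copy_id. Qed.

Lemma equal_at_sym a i j : equal_at a i j -> equal_at a j i.
Proof. by move=> h; rewrite /equal_at -{1}h copy_sym h. Qed.

Lemma equal_at_trans a j i k :
  equal_at a i j -> equal_at a j k -> equal_at a i k.
Proof. by move=> h1 h2; rewrite /equal_at -{1}h2 -copy_alias h2. Qed.

Definition redirect i j k := if k == i then j else k.

Lemma redirect_id i j k : k != i -> redirect i j k = k.
Proof. by rewrite /redirect => /negbTE ->. Qed.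

Lemma redirect_same i k : redirect i i k = k.
Proof. by rewrite /redirect; case: eqP. Qed.

Lemma redirect_eq i j : redirect i j i = j.
Proof. by rewrite /redirect eqxx. Qed.

Lemma equal_at_copy_stable a i j p q : p != i -> q != i ->
  equal_at a p q -> equal_at a.{i := j} p q.
Proof.
move=> pi qi h; wlog jp : j / j != p => [wl|].
  case: (eqVneq j p) => [->|]; last exact: wl.
  case: (eqVneq q p) => [->|qp]; first exact: equal_at_refl.
  by rewrite -h copy_alias h; exact: wl.
by rewrite /equal_at copy_comm // h.
Qed.

(** After copying j onto i, the k-th term is the former term at
    [redirect i j k]. *)
Lemma equal_at_redirect a i j p q :
  equal_at a.{i := j} p q <-> equal_at a (redirect i j p) (redirect i j q).
Proof.
have E k : equal_at a.{i := j} k (redirect i j k).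
  rewrite /redirect; case: eqP => [->|_]; [exact: copy_idem|exact: equal_at_refl].
have [<-|ij] := eqVneq i j.
  by rewrite copy_id !redirect_same.
have R k : redirect i j k != i.
  by rewrite /redirect; case: (eqVneq k i) => // _; rewrite eq_sym.
split=> h.
  apply: copy_reflect (R p) (R q) (equal_at_trans (equal_at_sym (E p)) _).
  exact: equal_at_trans h (E q).
apply: equal_at_trans (E p) (equal_at_trans _ (equal_at_sym (E q))).
exact: equal_at_copy_stable.
Qed.

Lemma equal_at_agree x a b p q : p != x -> q != x -> agree_off x a b ->
  equal_at a p q -> equal_at b p q.
Proof.
move=> px qx ab h; apply: (@copy_reflect _ S x q) => //.
by rewrite -(ab q) //; exact: equal_at_copy_stable.
Qed.

(** * Exchanging two coordinates through a third *)

(** The coordinate x serves as a temporary register, so only the terms outside x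
    of the result are those of the transposition of i and j. *)
Definition swap x i j a := a.{x := i}.{i := j}.{j := x}.

Lemma swap_agree x i j a b : i != x -> agree_off x a b ->
  swap x i j a = swap x i j b.
Proof. by move=> ix h; rewrite /swap h. Qed.

(** The merry-go-round identity with two of its indices equal: an exchange may
    start at either end. *)
Lemma swapC x i j a : i != x -> j != x -> i != j ->
  agree_off x (swap x i j a) (swap x j i a).
Proof.
move=> ix jx ij l lx.
have := @copy_mgr I S x i i j l a; rewrite !copy_id; apply=> //.
  by rewrite !inE !negb_or (eq_sym x) ix eq_sym jx.
by rewrite !inE !negb_or eq_sym ij.
Qed.

(** Between two consecutive exchanges the register is saved and restored, and
    this detour can be cut out. *)
Lemma swap_swap x i j k a : j != k ->
  swap x j k (swap x i j a) = a.{x := i}.{i := j}.{j := k}.{k := x}.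
Proof. by move=> jk; rewrite /swap copy_sym copy_over // eq_sym. Qed.

Lemma swapK x i j a : i != x -> j != x -> i != j ->
  agree_off x (swap x j i (swap x i j a)) a.
Proof.
move=> ix jx ij; rewrite swap_swap 1?eq_sym // copy_sym copy_over 1?eq_sym //.
rewrite copy_sym; exact: copy_agree.
Qed.

(** Both sides are 3-cycles, started at different places of the cycle; this is
    the merry-go-round identity for three distinct indices. *)
Lemma swap_rotate x i j k a : i != x -> j != x -> k != x ->
  i != j -> j != k -> k != i ->
  agree_off x (swap x j k (swap x i j a)) (swap x k i (swap x j k a)).
Proof.
move=> ix jx kx ij jk ki l lx.
rewrite !swap_swap //; apply/esym.
have := @copy_mgr I S x j k i l a; apply=> //.
  by rewrite !inE !negb_or !(eq_sym x) ix jx kx.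
by rewrite !inE !negb_or ij eq_sym ki.
Qed.

Lemma swap_invol x i j a : i != x -> j != x -> i != j ->
  agree_off x (swap x i j (swap x i j a)) a.
Proof.
move=> ix jx ij; apply: (agree_off_trans _ (swapK a ix jx ij)).
by apply: swapC.
Qed.

(** The right-hand side exchanges k and l through j rather than x, at a moment
    when j is free because its value has already been moved to i. Read as
    exchanges through x, it is (i j)(j k)(k l)(l j), and the last three factors
    reduce to (k l) by rotating a 3-cycle. *)
Lemma swap_pass x i j k l a : i != x -> j != x -> k != x -> l != x ->
  i != j -> i != k -> i != l -> j != k -> j != l -> k != l ->
  agree_off x (swap x k l (swap x i j a))
    a.{x := i}.{i := j}.{j := k}.{k := l}.{l := j}.{j := x}.
Proof.
move=> ix jx kx lx ij ik il jk jl kl.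
have -> : a.{x := i}.{i := j}.{j := k}.{k := l}.{l := j}.{j := x}
    = swap x l j (swap x k l (swap x j k (swap x i j a))).
  by rewrite !swap_swap 1?[l == j]eq_sym // copy_sym copy_over // eq_sym.
set b := swap x i j a; apply: agree_off_sym.
apply: (@agree_off_trans x (swap x k l (swap x j k (swap x j k b)))).
  by apply: agree_off_sym; apply: swap_rotate => //; rewrite eq_sym.
by move=> m mx; rewrite (swap_agree l kx (swap_invol _ jx kx jk)).
Qed.

(** Exchanging k and l through i and then moving the hole from i to j is the same
    as moving the hole first and exchanging through j; the final j := i only fixes
    the value left in the hole. *)
Lemma hole_pass i j k l a :
  i != j -> i != k -> i != l -> j != k -> j != l -> k != l ->
  a.{i := k}.{k := l}.{l := i}.{i := j}
    = a.{i := j}.{j := k}.{k := l}.{l := j}.{j := i}.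
Proof.
move=> ij ik il jk jl kl.
have h : agree_off i a.{i := j}.{j := k}.{k := l}.{l := j}.{j := i} (swap i k l a).
  have -> : a.{i := j}.{j := k}.{k := l}.{l := j}.{j := i}
      = swap i l j (swap i k l (swap i j k a)).
    by rewrite !swap_swap 1?[l == j]eq_sym // copy_sym copy_over // eq_sym.
  have [ki li ji] : [/\ k != i, l != i & j != i] by rewrite ![_ == i]eq_sym.
  apply: (@agree_off_trans i (swap i k l (swap i j k (swap i j k a)))).
    by apply: agree_off_sym; apply: swap_rotate => //; rewrite eq_sym.
  by move=> m mi; rewrite (swap_agree l ki (swap_invol _ ji ki jk)).
by rewrite -/(swap i k l a) -h 1?eq_sym // copy_sym.
Qed.

(** Commutation of disjoint exchanges is not among the axioms: an exchange
    through x can be made to act while the hole has moved to i and then to j,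
    and [hole_pass] slides it from one end of the other exchange to the other. *)
Lemma swap_disjoint x i j k l a : i != x -> j != x -> k != x -> l != x ->
  i != j -> i != k -> i != l -> j != k -> j != l -> k != l ->
  agree_off x (swap x k l (swap x i j a)) (swap x i j (swap x k l a)).
Proof.
move=> ix jx kx lx ij ik il jk jl kl.
apply: agree_off_trans (@swap_pass x i j k l a _ _ _ _ _ _ _ _ _ _) _ => //.
suff -> : swap x i j (swap x k l a)
  = a.{x := i}.{i := j}.{j := k}.{k := l}.{l := j}.{j := x} by [].
have [xi xj xk xl] : [/\ x != i, x != j, x != k & x != l] by rewrite ![x == _]eq_sym.
rewrite /swap hole_pass // copy_over 1?eq_sym //.
by rewrite (hole_pass a.{x := i} ij ik il jk jl kl) copy_over.
Qed.

End Points.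

(** * Words of copies and the maps they induce *)

Ltac split_eqs := rewrite ?eqxx /=;
  repeat (match goal with
  | H : is_true (?p != ?p) |- _ => by rewrite eqxx in H
  | |- context [?p == ?q] => is_var p; is_var q;
      case: (eqVneq p q) => [?|?]; subst; rewrite ?eqxx /=
  end).

Section Sequences.
Variables (I : eqType) (T : Type).
Implicit Types (i j k l p : I) (y : I -> T).

Definition seq_copy i j y : I -> T := [eta y with i |-> y j].

Lemma seq_copyE i j y k : seq_copy i j y k = y (redirect i j k).
Proof. by rewrite /seq_copy /redirect /=; case: ifP. Qed.

Fact seq_copy_id i y : seq_copy i i y = y.
Proof. by apply/funext => p; rewrite seq_copyE /redirect; split_eqs. Qed.

Fact seq_copy_over i j k y : k != i ->
  seq_copy i k (seq_copy i j y) = seq_copy i k y.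
Proof. by move=> ki; apply/funext => p; rewrite !seq_copyE /redirect; split_eqs. Qed.

Fact seq_copy_comm i j k l y : k != i -> l != i -> j != k ->
  seq_copy k l (seq_copy i j y) = seq_copy i j (seq_copy k l y).
Proof.
by move=> ki li jk; apply/funext => p; rewrite !seq_copyE /redirect; split_eqs.
Qed.

Fact seq_copy_reflect i j k l y : k != i -> l != i ->
  seq_copy k l (seq_copy i j y) = seq_copy i j y -> seq_copy k l y = y.
Proof.
move=> ki li /(congr1 (fun f => f k)) h; apply/funext => p; move: h.
by rewrite !seq_copyE /redirect; split_eqs.
Qed.

Fact seq_copy_alias i j k y :
  seq_copy i j (seq_copy j k y) = seq_copy i k (seq_copy j k y).
Proof. by apply/funext => p; rewrite !seq_copyE /redirect; split_eqs. Qed.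

Fact seq_copy_mgr k i j m l y :
  k \notin [:: i; j; m] -> m \notin [:: i; j] -> l != k ->
  seq_copy k l (seq_copy m k (seq_copy j m (seq_copy i j (seq_copy k i y))))
    = seq_copy k l (seq_copy j k (seq_copy i j (seq_copy m i (seq_copy k m y)))).
Proof.
rewrite !inE !negb_or => /and3P[ki kj km] /andP[mi mj] lk.
by apply/funext => p; rewrite !seq_copyE /redirect; split_eqs.
Qed.

(** An identity between words of copies that holds in every system holds in this
    one, where it can be read as an identity between maps on indices. *)
Definition seq_system : subst_system I :=
  SubstSystem seq_copy_id seq_copy_over seq_copy_comm seq_copy_reflect
    seq_copy_alias seq_copy_mgr.

Lemma seq_systemE i j (y : seq_system) k : y.{i := j} k = y (redirect i j k).
Proof. exact: seq_copyE. Qed.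

End Sequences.

Definition word (I : Type) := seq (I * I).

Fixpoint run (I : eqType) (S : subst_system I) (w : word I) (a : S) : S :=
  if w is p :: w' then run w' a.{p.1 := p.2} else a.

(** Copies act on sequences by composition on the right: running [w] on y yields
    y \o wmap w ([run_seq]), so the first letter is applied last. *)
Definition wmap (I : eqType) (w : word I) (k : I) : I :=
  foldr (fun p => redirect p.1 p.2) k w.

Section Words.
Variable I : eqType.
Implicit Types (i j k l x : I) (w : word I) (S : subst_system I).

Lemma run_cat S w w' (a : S) : run (w ++ w') a = run w' (run w a).
Proof. by elim: w a => //= p w IH a. Qed.

Lemma run_rcons S w p (a : S) : run (rcons w p) a = (run w a).{p.1 := p.2}.
Proof. by rewrite -cats1 run_cat. Qed.

Lemma wmap_cat w w' k : wmap (w ++ w') k = wmap w (wmap w' k).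
Proof. by rewrite /wmap foldr_cat. Qed.

Lemma wmap_rcons w p k : wmap (rcons w p) k = wmap w (redirect p.1 p.2 k).
Proof. by rewrite -cats1 wmap_cat. Qed.

Lemma run_seq T w (y : seq_system I T) k : run w y k = y (wmap w k).
Proof. by elim: w y => //= p w IH y; rewrite IH [LHS]seq_copyE. Qed.

Lemma run_seq_id w : run w (id : seq_system I I) = wmap w.
Proof. by apply/funext => k; rewrite run_seq. Qed.

(** A term that [w] never passes on to the final result does not matter. The
    value at x may still be copied to i and be lost later; in that case i is
    outside the range of the remaining word as well, and the induction
    hypothesis is used for both coordinates. *)
Lemma run_agree S x w (a b : S) : (forall k, wmap w k != x) ->
  agree_off x a b -> run w a = run w b.
Proof.
elim: w x a b => [|[i j] w IH] x a b /= hx ab; first by have := hx x; rewrite eqxx.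
have [eix|ix] := eqVneq i x.
  have [ejx|jx] := eqVneq j x.
    subst; rewrite !copy_id; apply: IH ab => k.
    have := hx k; rewrite /redirect.
    by case: (eqVneq (wmap w k) x) => // _; rewrite eqxx.
  by rewrite eix ab.
have hxw k : wmap w k != x.
  by have := hx k; rewrite /redirect; case: (eqVneq (wmap w k) i) => [->|].
have [ejx|jx] := eqVneq j x; last by apply: IH hxw _; exact: agree_off_copy.
have hiw k : wmap w k != i.
  have := hx k; rewrite /redirect ejx.
  by case: (eqVneq (wmap w k) i) => // _; rewrite eqxx.
rewrite (IH i _ a hiw (copy_agree _ _)) (IH i _ b hiw (copy_agree _ _)).
exact: IH hxw ab.
Qed.

Lemma equal_at_run S w (a : S) p q :
  equal_at (run w a) p q <-> equal_at a (wmap w p) (wmap w q).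
Proof.
elim/last_ind: w p q => [|w [i j] IH] p q //=.
by rewrite run_rcons !wmap_rcons equal_at_redirect.
Qed.

Lemma equal_at_wmap S w (a : S) p q : wmap w p = wmap w q ->
  equal_at (run w a) p q.
Proof. by move=> h; apply/equal_at_run; rewrite h; exact: equal_at_refl. Qed.

(** Writing to a coordinate that the rest of the word never uses is idle. *)
Lemma skip_copy S w (a : S) i j : (forall k, wmap w k != i) ->
  run w a.{i := j} = run w a.
Proof. by move=> h; apply: run_agree h _; exact: copy_agree. Qed.

(** * Lists of exchanges *)

Definition swap_word x i j : word I :=
  if i == j then [::] else [:: (x, i); (i, j); (j, x)].

Lemma run_swap_word S x i j (a : S) : i != j -> run (swap_word x i j) a = swap x i j a.
Proof. by rewrite /swap_word => /negbTE ->. Qed.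

Definition swaps_word x (s : seq (I * I)) : word I :=
  flatten [seq swap_word x p.1 p.2 | p <- s].

Lemma swaps_word_cat x s s' : swaps_word x (s ++ s') = swaps_word x s ++ swaps_word x s'.
Proof. by rewrite /swaps_word map_cat flatten_cat. Qed.

Definition swaps_in (P : pred I) (s : seq (I * I)) := all (fun p => P p.1 && P p.2) s.

Lemma swaps_in_rcons P s p : swaps_in P (rcons s p) = swaps_in P s && (P p.1 && P p.2).
Proof. by rewrite /swaps_in all_rcons andbC. Qed.

Lemma swaps_in_cat P s s' : swaps_in P (s ++ s') = swaps_in P s && swaps_in P s'.
Proof. exact: all_cat. Qed.

Lemma run_swaps_word_agree S x s (a b : S) : swaps_in (predC1 x) s ->
  agree_off x a b -> agree_off x (run (swaps_word x s) a) (run (swaps_word x s) b).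
Proof.
elim: s a b => [|[i j] s IH] a b //= /andP[/andP[/= ix jx] hs] ab.
rewrite /swaps_word /= -/(swaps_word x s) !run_cat; apply: IH => //.
have [<-|ij] := eqVneq i j; first by rewrite /swap_word eqxx.
by rewrite !run_swap_word // (swap_agree _ ix ab).
Qed.

(** Quantifying over all systems makes the relation determine the induced map on
    indices other than x ([wmap_swaps_eq]), by evaluation on sequences. *)
Definition swaps_eq x s s' :=
  forall S (a : S), agree_off x (run (swaps_word x s) a) (run (swaps_word x s') a).

Lemma swaps_eq_trans x s' s s'' : swaps_eq x s s' -> swaps_eq x s' s'' -> swaps_eq x s s''.
Proof. by move=> h1 h2 S a; apply: agree_off_trans (h1 S a) (h2 S a). Qed.

Lemma swaps_eq_sym x s s' : swaps_eq x s s' -> swaps_eq x s' s.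
Proof. by move=> h S a; apply: agree_off_sym. Qed.

Lemma wmap_swaps_eq x s s' k : swaps_eq x s s' -> k != x ->
  wmap (swaps_word x s) k = wmap (swaps_word x s') k.
Proof.
move=> h kx; have := h (seq_system I I) id k kx.
move/(congr1 (fun f => f k)); rewrite /= /seq_copy /= (negbTE kx).
by rewrite !run_seq_id.
Qed.

End Words.

Section Sorting.
Variable I : finType.
Implicit Types (i j k l x z : I) (X : {set I}) (S : subst_system I).
Implicit Types (s : seq (I * I)).

Lemma swaps_eq_catl x s1 s s' : swaps_eq x s s' -> swaps_eq x (s1 ++ s) (s1 ++ s').
Proof. by move=> h S a; rewrite !swaps_word_cat !run_cat. Qed.

Lemma swaps_eq_catr x s2 s s' : swaps_in (predC1 x) s2 -> swaps_eq x s s' ->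
  swaps_eq x (s ++ s2) (s' ++ s2).
Proof.
by move=> h2 h S a; rewrite !swaps_word_cat !run_cat; apply: run_swaps_word_agree.
Qed.

Lemma swaps_eq_nil x i : swaps_eq x [:: (i, i)] [::].
Proof. by move=> S a; rewrite /swaps_word /= /swap_word eqxx. Qed.

Lemma run_swaps_word1 S x i j (a : S) : i != j ->
  run (swaps_word x [:: (i, j)]) a = swap x i j a.
Proof. by move=> ij; rewrite /swaps_word /= cats0 run_swap_word. Qed.

Lemma run_swaps_word2 S x i j k l (a : S) : i != j -> k != l ->
  run (swaps_word x [:: (i, j); (k, l)]) a = swap x k l (swap x i j a).
Proof. by move=> ij kl; rewrite /swaps_word /= cats0 run_cat !run_swap_word. Qed.

Lemma swaps_eq_swapC x i j : i != x -> j != x -> swaps_eq x [:: (i, j)] [:: (j, i)].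
Proof.
move=> ix jx S a; have [->//|ij] := eqVneq i j.
by rewrite !run_swaps_word1 // 1?eq_sym //; exact: swapC.
Qed.

Lemma swaps_eq_swapK x i j : i != x -> j != x -> swaps_eq x [:: (i, j); (i, j)] [::].
Proof.
move=> ix jx S a; have [->|ij] := eqVneq i j.
  by rewrite /swaps_word /= /swap_word eqxx.
by rewrite run_swaps_word2 //; exact: swap_invol.
Qed.

Lemma swaps_eq_rotate x i j k : i != x -> j != x -> k != x ->
  i != j -> j != k -> k != i ->
  swaps_eq x [:: (i, j); (j, k)] [:: (j, k); (k, i)].
Proof. by move=> *; move=> S a; rewrite !run_swaps_word2 //; exact: swap_rotate. Qed.

Lemma swaps_eq_disjoint x i j k l : i != x -> j != x -> k != x -> l != x ->
  i != k -> i != l -> j != k -> j != l ->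
  swaps_eq x [:: (i, j); (k, l)] [:: (k, l); (i, j)].
Proof.
move=> ix jx kx lx ik il jk jl S a.
have [->|ij] := eqVneq i j; first by rewrite /swaps_word /= /swap_word eqxx !cats0.
have [->|kl] := eqVneq k l; first by rewrite /swaps_word /= /swap_word eqxx !cats0.
by rewrite !run_swaps_word2 //; exact: swap_disjoint.
Qed.

Lemma swaps_in_sub (P Q : pred I) s : subpred P Q -> swaps_in P s -> swaps_in Q s.
Proof. by move=> h; apply: sub_all => p /andP[/h h1 /h h2]; rewrite h1. Qed.

(** Two rotations of the 3-cycle, up to reversing the exchanges. *)
Lemma swaps_eq_conj x z j l : z != x -> j != x -> l != x ->
  z != j -> j != l -> l != z ->
  swaps_eq x [:: (j, l); (z, j)] [:: (z, l); (j, l)].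
Proof.
move=> zx jx lx zj jl lz.
apply: (@swaps_eq_trans _ x [:: (l, j); (j, z)]).
  apply: (@swaps_eq_trans _ x [:: (l, j); (z, j)]).
    by apply: (@swaps_eq_catr x [:: (z, j)] [:: (j, l)] [:: (l, j)]);
      [rewrite /= zx jx|apply: swaps_eq_swapC].
  by apply: (@swaps_eq_catl x [:: (l, j)]); apply: swaps_eq_swapC.
apply: (@swaps_eq_trans _ x [:: (j, z); (z, l)]).
  by apply: swaps_eq_rotate; rewrite // eq_sym.
apply: (@swaps_eq_trans _ x [:: (z, l); (l, j)]).
  by apply: swaps_eq_rotate; rewrite // eq_sym.
by apply: (@swaps_eq_catl x [:: (z, l)]); apply: swaps_eq_swapC.
Qed.

(** Moving an exchange of z to the front past exchanges that do not involve z
    only changes its partner, by conjugation. *)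
Lemma push_swap x z X s j : x \notin X -> z \in X ->
  swaps_in [in X :\ z] s -> j \in X :\ z ->
  exists l s', [/\ l \in X :\ z, swaps_in [in X :\ z] s' &
    swaps_eq x (rcons s (z, j)) ((z, l) :: s')].
Proof.
move=> xX zX; have X' i : i \in X -> i != x by apply: contraTneq => ->.
elim/last_ind: s j => [|s [k l] IH] j; first by exists j, [::].
rewrite swaps_in_rcons => /and3P[hs /= /[dup] kX /setD1P[kz /X' kx]].
move=> /[dup] lX /setD1P[lz /X' lx] /[dup] jX /setD1P[jz /X' jx].
have zx := X' _ zX.
have zj : z != j by rewrite eq_sym.
have step m t : swaps_in (predC1 x) t -> swaps_in [in X :\ z] t -> m \in X :\ z ->
    swaps_eq x [:: (k, l); (z, j)] ((z, m) :: t) ->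
    exists l' s', [/\ l' \in X :\ z, swaps_in [in X :\ z] s' &
      swaps_eq x (rcons (rcons s (k, l)) (z, j)) ((z, l') :: s')].
  move=> ht ht' mX h.
  have [l' [s' [h1 h2 h3]]] := IH _ hs mX; exists l', (s' ++ t); split=> //.
    by rewrite swaps_in_cat h2.
  rewrite -!cats1 -catA /=; apply: swaps_eq_trans (swaps_eq_catl s h) _.
  rewrite -cat_rcons; exact: (swaps_eq_catr ht h3).
have [ekl|kl] := eqVneq k l.
  subst l; apply: (step j [::]) => //.
  apply: (@swaps_eq_catr x [:: (z, j)] [:: (k, k)] [::]); last exact: swaps_eq_nil.
  by rewrite /= zx jx.
have [ejk|jk] := eqVneq j k.
  subst k; apply: (step l [:: (j, l)]); rewrite /= ?jx ?lx ?jX ?lX //.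
  by apply: swaps_eq_conj.
have [ejl|jl] := eqVneq j l.
  subst l; apply: (step k [:: (j, k)]); rewrite /= ?jx ?kx ?jX ?kX //.
  apply: (@swaps_eq_trans _ x [:: (j, k); (z, j)]); last exact: swaps_eq_conj.
  apply: (@swaps_eq_catr x [:: (z, j)] [:: (k, j)] [:: (j, k)]); last exact: swaps_eq_swapC.
  by rewrite /= zx jx.
apply: (step j [:: (k, l)]); rewrite /= ?kx ?lx ?kX ?lX //.
by apply: swaps_eq_disjoint; rewrite // eq_sym.
Qed.

(** Sorting: the first exchange brings the right value to z, and z is never
    touched again. Repeating this for all z gives a form that depends only on
    the permutation. *)
Lemma peel_swap x z X s : x \notin X -> z \in X -> swaps_in [in X] s ->
  exists v s', [/\ v \in X, swaps_in [in X :\ z] s' & swaps_eq x s ((z, v) :: s')].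
Proof.
move=> xX zX; have X' i : i \in X -> i != x by apply: contraTneq => ->.
have zx := X' _ zX.
elim/last_ind: s => [|s [i j] IH].
  by exists z, [::]; split=> //; apply: swaps_eq_sym; exact: swaps_eq_nil.
rewrite swaps_in_rcons => /and3P[/IH[v [s' [vX hs' e]]] /= iX jX].
have ix := X' _ iX; have jx := X' _ jX; have vx := X' _ vX.
have {}e : swaps_eq x (rcons s (i, j)) ((z, v) :: rcons s' (i, j)).
  rewrite -!cats1 -cat_cons; apply: swaps_eq_catr e.
  by rewrite /= ix jx.
have off s1 : swaps_in [in X :\ z] s1 -> swaps_in (predC1 x) s1.
  by apply: swaps_in_sub => m /setD1P[_ /X'].
have withz m : m \in X :\ z ->
    swaps_eq x (rcons s (i, j)) ((z, v) :: rcons s' (z, m)) ->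
    exists v0 s0, [/\ v0 \in X, swaps_in [in X :\ z] s0 &
      swaps_eq x (rcons s (i, j)) ((z, v0) :: s0)].
  move=> mX {}e.
  have [l [s3 [lX hs3 e3]]] := push_swap xX zX hs' mX.
  have [lz {}lX] := setD1P lX; have lx := X' _ lX.
  have {e3}e := swaps_eq_trans e (swaps_eq_catl [:: (z, v)] e3).
  have [evz|vz] := eqVneq v z.
    subst v; exists l, s3; split=> //; apply: (swaps_eq_trans e).
    apply: (@swaps_eq_catr x ((z, l) :: s3) [:: (z, z)] [::]); last exact: swaps_eq_nil.
    by rewrite /= zx lx; exact: off.
  have [evl|vl] := eqVneq v l.
    subst v; exists z, s3; split=> //; apply: (swaps_eq_trans e).
    apply: (swaps_eq_trans (swaps_eq_catr (off _ hs3) (swaps_eq_swapK zx lx))).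
    exact: (@swaps_eq_catr x s3 [::] [:: (z, z)] (off _ hs3) 
      (swaps_eq_sym (@swaps_eq_nil x z))).
  exists l, ((l, v) :: s3); split=> //.
    by rewrite /= !in_setD1 lz lX vz vX.
  apply: (swaps_eq_trans e).
  apply: (@swaps_eq_catr x s3 [:: (z, v); (z, l)] [:: (z, l); (l, v)]).
    exact: off.
  apply: (@swaps_eq_trans _ x [:: (v, z); (z, l)]).
    apply: (@swaps_eq_catr x [:: (z, l)] [:: (z, v)] [:: (v, z)]); last exact: swaps_eq_swapC.
    by rewrite /= zx lx.
  by apply: swaps_eq_rotate => //; rewrite eq_sym.
have [eiz|iz] := eqVneq i z.
  subst i; have [ejz|jz] := eqVneq j z.
    subst j; exists v, s'; split=> //; apply: (swaps_eq_trans e).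
    rewrite -cats1 -cat_cons -[X in swaps_eq _ _ X]cats0.
    by apply: swaps_eq_catl; exact: swaps_eq_nil.
  by apply: (withz j) => //; rewrite in_setD1 jz.
have [ejz|jz] := eqVneq j z.
  subst j; apply: (withz i); first by rewrite in_setD1 iz.
  apply: (swaps_eq_trans e); rewrite -!cats1 -!cat_cons.
  by apply: swaps_eq_catl; exact: swaps_eq_swapC.
exists v, (rcons s' (i, j)); split=> //.
by rewrite swaps_in_rcons hs' !in_setD1 iz jz iX jX.
Qed.

End Sorting.

(** * Words with the same map act equally *)

Section WordProblem.
Variable I : finType.
Implicit Types (i j k l h x z : I) (X : {set I}) (S : subst_system I).
Implicit Types (s : seq (I * I)) (c u w : word I).

Lemma run_eq_wmap w w' k :
  (forall S (a : S), run w a = run w' a) -> wmap w k = wmap w' k.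
Proof. by move=> h; rewrite -!run_seq_id h. Qed.

Lemma wmap_swap_word x i j k : i != x -> j != x -> k != x ->
  wmap (swap_word x i j) k = if k == i then j else if k == j then i else k.
Proof.
move=> ix jx kx; rewrite /swap_word; have [<-|ij] := eqVneq i j.
  by case: eqP => [->|//].
by rewrite /= /redirect; split_eqs.
Qed.

Lemma wmap_swaps_word_cons x p s k :
  wmap (swaps_word x (p :: s)) k = wmap (swap_word x p.1 p.2) (wmap (swaps_word x s) k).
Proof. by rewrite /swaps_word /= wmap_cat. Qed.

Lemma run_swaps_word_cons S x p s (a : S) :
  run (swaps_word x (p :: s)) a = run (swaps_word x s) (run (swap_word x p.1 p.2) a).
Proof. by rewrite /swaps_word /= run_cat. Qed.

Lemma wmap_swaps_word_off x s k : swaps_in (predC1 x) s -> k != x ->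
  wmap (swaps_word x s) k != x.
Proof.
move=> hs kx; elim: s hs => //= -[i j] s IH /andP[/andP[/= ix jx] /IH {}IH].
by rewrite wmap_swaps_word_cons wmap_swap_word //=; do 2?case: ifP.
Qed.

Lemma wmap_swaps_word_fix x z s : swaps_in (predC1 x) s -> swaps_in (predC1 z) s ->
  z != x -> wmap (swaps_word x s) z = z.
Proof.
move=> hs hz zx; elim: s hs hz => //= -[i j] s IH.
move=> /andP[/andP[/= ix jx] /IH {}IH] /andP[/andP[/= iz jz] /IH {}IH].
by rewrite wmap_swaps_word_cons IH wmap_swap_word //= ![z == _]eq_sym (negbTE iz) (negbTE jz).
Qed.

Lemma wmap_swap_word_inj x i j k l : i != x -> j != x -> k != x -> l != x ->
  wmap (swap_word x i j) k = wmap (swap_word x i j) l -> k = l.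
Proof.
move=> ix jx kx lx; rewrite !wmap_swap_word //.
by split_eqs; move=> E; subst; split_eqs.
Qed.

(** Exchanges among coordinates that [c] discards are idle. *)
Lemma skip_swaps S x X c s (a : S) : x \notin X ->
  (forall k, wmap c k != x) -> (forall k, wmap c k \notin X) ->
  swaps_in [in X] s -> run c (run (swaps_word x s) a) = run c a.
Proof.
move=> xX cx cX; elim: s a => [|[i j] s IH] a //= /andP[/andP[/= iX jX] hs].
rewrite /swaps_word /= -/(swaps_word x s) run_cat IH //.
have out y : y \in X -> forall k, wmap c k != y.
  by move=> yX k; apply: contraNneq (cX k) => ->.
have [->|ij] := eqVneq i j; first by rewrite /swap_word eqxx.
by rewrite run_swap_word // /swap !skip_copy //; exact: out.
Qed.

(** Followed by a word [c], a list of exchanges matters only through the values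
    it brings to the range of [c]. One peels off the coordinates z of that range
    one by one: the leading exchange is the same on both sides, and what is left
    once no such z remains is idle. *)
Lemma swaps_determined x c X s s' : (forall k, wmap c k != x) -> x \notin X ->
  swaps_in [in X] s -> swaps_in [in X] s' ->
  (forall k, wmap (swaps_word x s) (wmap c k) = wmap (swaps_word x s') (wmap c k)) ->
  forall S (a : S), run (swaps_word x s ++ c) a = run (swaps_word x s' ++ c) a.
Proof.
move=> cx; move: {2}#|X| (leqnn #|X|) => n.
elim: n X s s' => [|n IH] X s s' Xn xX hs hs' e S a.
all: have [cX|/forallPn[p /negbNE zX]] := boolP [forall k, wmap c k \notin X];
  first by rewrite !run_cat !(skip_swaps _ xX cx (forallP cX)).
  by move: Xn; rewrite leqn0 cards_eq0 => /eqP X0; rewrite X0 inE in zX.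
set z := wmap c p in zX; have zx : z != x by exact: cx.
have off t : swaps_in [in X :\ z] t -> swaps_in (predC1 x) t.
  by apply: swaps_in_sub => m /setD1P[_]; apply: contraTneq => ->.
have offz t : swaps_in [in X :\ z] t -> swaps_in (predC1 z) t.
  by apply: swaps_in_sub => m /setD1P[].
have val v t : v \in X -> swaps_in [in X :\ z] t ->
    wmap (swaps_word x ((z, v) :: t)) z = v.
  move=> vX ht; rewrite wmap_swaps_word_cons wmap_swaps_word_fix ?off ?offz //=.
  by rewrite wmap_swap_word ?eqxx //; apply: contraTneq vX => ->.
have [v [t [vX ht et]]] := peel_swap xX zX hs.
have [v' [t' [vX' ht' et']]] := peel_swap xX zX hs'.
have evv : v = v'.
  by have := e p; rewrite -/z (wmap_swaps_eq et zx) (wmap_swaps_eq et' zx) !val.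
subst v'; have vx : v != x by apply: contraTneq vX => ->.
rewrite !run_cat (run_agree cx (et S a)) (run_agree cx (et' S a)).
rewrite !run_swaps_word_cons -(run_cat (swaps_word x t)) -(run_cat (swaps_word x t')).
apply: (IH (X :\ z)) => // [||k].
- by move: Xn; rewrite (cardsD1 z) zX.
- by rewrite in_setD1 (negbTE xX) andbF.
have := e k; rewrite (wmap_swaps_eq et) // (wmap_swaps_eq et') //.
rewrite !wmap_swaps_word_cons.
by apply: wmap_swap_word_inj => //; apply: wmap_swaps_word_off => //; exact: off.
Qed.

Definition misses c h := forall k, wmap c k != h.

(** Of two discarded coordinates, either may be the one that supplies the x-th
    term, up to an exchange. *)
Lemma rehole x c h l : misses c h -> misses c l ->
  exists2 s, swaps_in (predC1 x) s & forall S (a : S),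
    run ((x, l) :: c) a = run (swaps_word x s ++ (x, h) :: c) a.
Proof.
move=> ch cl; have [/forallP cx|] := boolP [forall k, wmap c k != x].
  by exists [::] => //= S a; rewrite !skip_copy.
rewrite negb_forall => /existsP[k /negbNE/eqP ck].
have hx : h != x by rewrite -ck eq_sym.
have lx : l != x by rewrite -ck eq_sym.
exists [:: (l, h)] => [|S a]; first by rewrite /= lx hx.
rewrite run_cat /=; have [->|lh] := eqVneq l h.
  by rewrite /swaps_word /= /swap_word eqxx.
by rewrite run_swaps_word1 // /swap copy_sym (skip_copy _ _ ch) (skip_copy _ _ cl).
Qed.

(** The core of the word problem. After x := j a coordinate is free; if the word
    [u] preserves all values that [c] will use, it can be rewritten as exchanges
    through x. A last copy k := l of [u] is moved into [c]: the enlarged word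
    discards k, and if [c] uses k then [c] discards l, so that the copy is half of
    an exchange of k and l. The h-th coordinate supplies the value
    of x, which may itself be used by [c]. *)
Lemma sort_injective x j u c h : j != x ->
  (forall p q, redirect x j (wmap u (wmap c p)) = redirect x j (wmap u (wmap c q)) ->
    wmap c p = wmap c q) ->
  misses c h ->
  exists2 s, swaps_in (predC1 x) s & forall S (a : S),
    run ((x, j) :: u ++ c) a = run (swaps_word x s ++ (x, h) :: c) a.
Proof.
move=> jx; elim/last_ind: u c h => [|u [k l] IH] c h inj ch.
  have [/forallP cj|] := boolP [forall k, wmap c k != j]; first exact: rehole.
  rewrite negb_forall => /existsP[k /negbNE/eqP ck].
  have cx : misses c x.
    move=> m; apply/eqP => cm; have := inj k m.
    rewrite /= ck cm redirect_eq redirect_id // => /(_ erefl)/eqP.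
    by rewrite (negbTE jx).
  by exists [::] => // S a; rewrite /= !skip_copy.
have [/forallP ck|] := boolP [forall m, wmap c m != k].
  have [|s hs e] := IH c h _ ch.
    by move=> p q E; apply: inj; rewrite !wmap_rcons !(redirect_id _ (ck _)).
  by exists s => // S a; rewrite -e /= !run_cat run_rcons skip_copy.
rewrite negb_forall => /existsP[m /negbNE/eqP cm].
have [ekl|kl] := eqVneq k l.
  subst l; have [|s hs e] := IH c h _ ch.
    move=> p q E; apply: inj; rewrite !wmap_rcons /=.
    by rewrite !(redirect_same k).
  by exists s => // S a; rewrite -e /= !run_cat run_rcons copy_id.
have cl : misses c l.
  move=> q; apply/eqP => cq; have := inj m q.
  have lk : l != k by rewrite eq_sym.
  rewrite !wmap_rcons cm cq redirect_eq (redirect_id _ lk) => /(_ erefl)/eqP.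
  by rewrite (negbTE kl).
(* As the enlarged word discards k, the value of x can be taken from k, and
   x := k, k := l is then the beginning of an exchange. *)
have [||s hs e] := IH ((k, l) :: c) k.
- move=> p q E; congr redirect; apply: inj.
  by rewrite !wmap_rcons.
- move=> q; rewrite /= /redirect; case: (eqVneq (wmap c q) k) => //.
  by rewrite eq_sym.
suff [t ht e'] : exists2 t, swaps_in (predC1 x) t & forall S (a : S),
    run ((x, k) :: (k, l) :: c) a = run (swaps_word x t ++ (x, h) :: c) a.
  exists (s ++ t) => [|S a]; first by rewrite swaps_in_cat hs.
  rewrite swaps_word_cat -catA run_cat -e' -run_cat -e.
  by rewrite /= !run_cat run_rcons.
have [ekx|kx] := eqVneq k x.
  have [t ht e'] := rehole x ch cl.
  by exists t => // S a; rewrite -e' /= ekx copy_id.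
have [elx|lx] := eqVneq l x.
  by exists [::] => // S a; rewrite /= elx copy_sym -elx !(skip_copy _ _ cl).
have [t ht e'] := rehole x ch cl.
exists ((k, l) :: t) => [|S a]; first by rewrite /= kx lx.
rewrite /swaps_word /= -/(swaps_word x t) -catA run_cat -e' run_swap_word // /swap /=.
by rewrite copy_sym (skip_copy _ _ cl).
Qed.

(** Collapses every class of indices onto its representative, for an idempotent
    choice [r] of representatives. *)
Definition collapse (r : I -> I) : word I := [seq (k, r k) | k <- enum I].

Lemma wmap_collapse r k : (forall k, r (r k) = r k) -> wmap (collapse r) k = r k.
Proof.
move=> rr; rewrite /collapse.
suff -> t : wmap [seq (k, r k) | k <- t] k = if k \in t then r k else k.
  by rewrite mem_enum.
elim: t => //= p t ->; rewrite inE /redirect; case: (eqVneq k p) => [->|kp] /=.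
  by case: (p \in t); rewrite ?eqxx ?if_same.
case: (k \in t); last by rewrite (negbTE kp).
by case: (eqVneq (r k) p) => // <-; rewrite rr.
Qed.

Lemma run_collapse S r (a : S) : (forall k, equal_at a k (r k)) ->
  run (collapse r) a = a.
Proof. by move=> h; rewrite /collapse; elim: (enum I) => //= k t IH; rewrite h. Qed.

(** No genuine copy is injective, so only copies of a term onto itself occur. *)
Lemma run_injective S w (a : S) : injective (wmap w) -> run w a = a.
Proof.
elim: w a => //= -[i j] w IH a inj.
have injw : injective (wmap w) by move=> p q E; apply: inj; rewrite /= E.
have [g gK Kg] := injF_bij injw.
have -> : i = j.
  have := inj (g i) (g j); rewrite /= !Kg redirect_eq.
  rewrite {1}/redirect; case: eqP => [->//|_] /(_ erefl) /(congr1 (wmap w)).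
  by rewrite !Kg.
by rewrite copy_id IH.
Qed.

Definition representative (e : rel I) k := odflt k [pick m | e k m].

Lemma representativeP (e : rel I) k : reflexive e -> e k (representative e k).
Proof.
by move=> er; rewrite /representative; case: pickP => //= m; rewrite er.
Qed.

Lemma representative_eq (e : rel I) k l : equivalence_rel e -> e k l ->
  representative e k = representative e l.
Proof.
move=> ee ekl; rewrite /representative.
have E m : e k m = e l m by have [_ /(_ ekl)] := ee k l m.
rewrite (eq_pick E); case: pickP => //= /(_ l).
by have [->] := ee l l l.
Qed.

(** A system of points is thus acted on by the monoid of self-maps of [I]
    generated by the maps i |-> j. If the common map is not injective, it misses
    some x, so one may first overwrite x, and it identifies some p and q, so one
    may afterwards collapse its kernel. Between these two ends only
    exchanges remain, and they are determined by the map. *)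
Theorem word_problem w w' : wmap w =1 wmap w' ->
  forall S (a : S), run w a = run w' a.
Proof.
move=> eww S a; have [/injectiveP inj|ninj] := boolP (injectiveb (wmap w)).
  rewrite !run_injective // => p q; rewrite -!eww; exact: inj.
have [p [q [pq epq]]] : exists p, exists q, p != q /\ wmap w p = wmap w q.
  by have /injectivePn[p [q pq epq]] := ninj; exists p, q.
have [x wx] : exists x, misses w x.
  have [/existsP[x /forallP wx]|/existsPn onto] :=
    boolP [exists x, [forall k, wmap w k != x]].
    by exists x.
  case/negP: ninj; apply/injectiveP => k l; apply/image_injP => //.
  apply/eqP/eq_card => x.
  have /forallPn[m /negbNE/eqP <-] := onto x.
  by rewrite [RHS]inE fintype.image_f ?inE.
pose e : rel I := fun k l => wmap w k == wmap w l.
have ee : equivalence_rel e.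
  by move=> k l m; rewrite /e eqxx; split=> // /eqP ->.
pose r := representative e; pose c := collapse r.
have wr k : wmap w (r k) = wmap w k.
  by apply/esym/eqP; apply: (@representativeP e) => ?; rewrite /e eqxx.
have rE k l : wmap w k = wmap w l -> r k = r l.
  by move=> E; apply: representative_eq => //; apply/eqP.
have rr k : r (r k) = r k by apply: rE.
have cE k : wmap c k = r k by apply: wmap_collapse.
(* Of two identified coordinates, one is not its own representative. *)
have [h ch] : exists h, misses c h.
  have [E|] := eqVneq (r p) p; last first.
    move=> rp; exists p => k; rewrite cE; apply: contra rp => /eqP <-.
    by rewrite rr.
  exists q => k; rewrite cE; apply: contra pq => /eqP E'.
  by rewrite -E (rE _ _ epq) -E' rr.
pose j := wmap w x; have jx : j != x by exact: wx.
have [s hs es] : exists2 s, swaps_in (predC1 x) s & forall S (a : S),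
    run ((x, j) :: w ++ c) a = run (swaps_word x s ++ (x, h) :: c) a.
  apply: sort_injective => // m n; rewrite !redirect_id ?wx // !cE !wr.
  exact: rE.
have [s' hs' es'] : exists2 s, swaps_in (predC1 x) s & forall S (a : S),
    run ((x, j) :: w' ++ c) a = run (swaps_word x s ++ (x, h) :: c) a.
  apply: sort_injective => // m n; rewrite -!eww !redirect_id ?wx // !cE !wr.
  exact: rE.
have red v : wmap w =1 wmap v -> run v a = run ((x, j) :: v ++ c) a.
  move=> ev; rewrite /= skip_copy => [|k]; last by rewrite wmap_cat -ev wx.
  rewrite run_cat run_collapse // => k; apply: equal_at_wmap.
  by rewrite -!ev wr.
rewrite (red w) // (red w') // es es'.
apply: (@swaps_determined x _ [set~ x]).
- move=> k; rewrite /= /redirect; case: (eqVneq (wmap c k) x) => // E.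
  by apply/eqP => hx; have := ch k; rewrite E hx eqxx.
- by rewrite !inE eqxx.
- by apply: swaps_in_sub hs => m; rewrite !inE.
- by apply: swaps_in_sub hs' => m; rewrite !inE.
move=> k; rewrite -!wmap_cat -(run_eq_wmap k es) -(run_eq_wmap k es').
by rewrite /= !wmap_cat eww.
Qed.

Definition equal_rel S (a : S) : rel I := fun k l => `[<equal_at a k l>].

Lemma equal_rel_equiv S (a : S) : equivalence_rel (equal_rel a).
Proof.
move=> k l m; split; first by apply/asboolP; exact: equal_at_refl.
move=> /asboolP kl; apply: asbool_equiv_eq; split=> [km|lm].
  exact: equal_at_trans (equal_at_sym kl) km.
exact: equal_at_trans kl lm.
Qed.

Definition leader S (a : S) k := representative (equal_rel a) k.

Lemma leaderP S (a : S) k : equal_at a k (leader a k).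
Proof.
apply/asboolP; apply: (@representativeP (equal_rel a)) => m.
by have [] := equal_rel_equiv a m m m.
Qed.

Lemma leader_eq S (a : S) k l : leader a k = leader a l <-> equal_at a k l.
Proof.
split=> [e|kl]; last first.
  by apply: representative_eq; [exact: equal_rel_equiv|exact/asboolP].
by apply: equal_at_trans (leaderP a k) _; rewrite e; exact/equal_at_sym/leaderP.
Qed.

(** If the terms of a are already known to coincide along an equivalence
    relation, collapsing that relation first changes nothing, so the maps need to
    agree only up to it. *)
Theorem run_equal_at S w w' (a : S) :
  (forall k, equal_at a (wmap w k) (wmap w' k)) -> run w a = run w' a.
Proof.
move=> h; have rr k : leader a (leader a k) = leader a k.
  by apply/leader_eq/equal_at_sym/leaderP.
have ca := run_collapse (leaderP a).
rewrite -ca -!run_cat; apply: word_problem => k.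
rewrite !wmap_cat !wmap_collapse //; exact/leader_eq.
Qed.

End WordProblem.

(** * Labelled sequences over a system of points *)

Section Unravelling.
Variables (I : finType) (S : subst_system I).
Implicit Types (i j k l : I) (w : word I) (a b : S).

(** The values of the labelled sequences. [Fresh y i b] is the value added at
    place i of y to obtain the label b: naming it after the request that creates
    it makes it new and makes each request create its own value. *)
Inductive vertex : Type :=
| Old of S & I
| Fresh of (I -> vertex) & I & S.

Implicit Types (u v : vertex) (y z : seq_system I vertex).

Notation seqs := (seq_system I vertex).

Definition base_seq a : seqs :=
  fun i => Old a (leader a i).

Definition extend y i b : seqs := [eta y with i |-> Fresh y i b].

(** The least labelling that contains every point, is closed under copies, and
    has the extensions required by cylindrifications. If b has its i-th term equal
    to another one, no new value may be used: a copy of the old sequence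
    already serves. *)
Inductive label : seqs -> S -> Prop :=
| label_base a : label (base_seq a) a
| label_extend y a i b : label y a -> agree_off i a b ->
    (forall j, j != i -> ~ equal_at b i j) -> label (extend y i b) b
| label_copy y a i j : label y a -> label y.{i := j} a.{i := j}.

Definition occurs_in u v := exists y i b k, v = Fresh y i b /\ u = y k.

(** Newness of [Fresh y i b] with respect to y is well-foundedness of the
    inductive type. *)
Lemma occurs_in_wf u : Acc occurs_in u.
Proof.
elim: u => [a i|y IH i b]; apply: Acc_intro => u [y' [i' [b' [k [e eu]]]]].
  discriminate e.
by rewrite eu; case: e => <- _ _; exact: IH.
Qed.

Lemma occurs_in_asym u v : occurs_in u v -> occurs_in v u -> False.
Proof. by elim: (occurs_in_wf u) v => {}u _ IH v uv vu; exact: (IH v vu u). Qed.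

Lemma fresh_notin y i b k : y k <> Fresh y i b.
Proof.
by move=> e; apply: (@occurs_in_asym (y k) (y k)); exists y, i, b, k.
Qed.

Lemma extend_eq y i b : extend y i b i = Fresh y i b.
Proof. by rewrite /extend /= eqxx. Qed.

Lemma extend_neq y i b k : k != i -> extend y i b k = y k.
Proof. by rewrite /extend /= => /negbTE ->. Qed.

Lemma extend_agree (y : seqs) i b : agree_off i (extend y i b) y.
Proof.
move=> j ji; apply/funext => k; rewrite !seq_systemE.
by rewrite extend_neq // /redirect; case: (eqVneq k i).
Qed.

Lemma base_seq_eq a k l : base_seq a k = base_seq a l <-> equal_at a k l.
Proof. by rewrite -leader_eq; split=> [[]|e]; last congr Old. Qed.

(** In the extension step the new value is different from all old ones, and the
    label says so too; the equalities among the other coordinates do not see the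
    change of label. *)
Lemma label_equal_at y a k l : label y a -> (y k = y l <-> equal_at a k l).
Proof.
move=> ya; elim: ya k l => {y a} [a|y a i b _ IH ab nb|y a i j _ IH] k l.
- exact: base_seq_eq.
- have [->|ki] := eqVneq k i; have [->|li] := eqVneq l i.
  + by split=> // _; exact: equal_at_refl.
  + rewrite extend_eq extend_neq //; split=> [/esym/fresh_notin //|].
    by move/(nb _ li).
  + rewrite extend_eq extend_neq //; split=> [/fresh_notin //|].
    by move/equal_at_sym/(nb _ ki).
  rewrite !extend_neq // IH; split; first exact: (equal_at_agree ki li ab).
  exact: (equal_at_agree ki li (agree_off_sym ab)).
by rewrite equal_at_redirect -IH !seq_systemE.
Qed.

(** A labelled sequence is obtained by copies from a sequence in which its newest
    value was introduced. *)
Variant origin (y : seqs) a : Prop :=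
| OldOrigin a0 w of y = run w (base_seq a0) & a = run w a0
| FreshOrigin y0 a0 i b w of label y0 a0 & agree_off i a0 b &
    (forall j, j != i -> ~ equal_at b i j) &
    y = run w (extend y0 i b) & a = run w b &
    (exists k, y k = Fresh y0 i b).

(** If the value introduced last has been lost in the copies, the step that
    introduced it can be skipped, by [run_agree] applied to the sequence as well as
    to the label. Strengthening over all words [w] lets the induction hypothesis
    absorb the copies made after that step. *)
Lemma label_origin y a : label y a -> origin y a.
Proof.
move=> ya; suff: forall w, origin (run w y) (run w a) by move/(_ [::]).
elim: ya => {y a} [a|y a i b ya IH ab nb|y a i j _ IH] w.
- exact: OldOrigin.
- have [/existsP[k /eqP wk]|/existsPn miss] := boolP [exists k, wmap w k == i].
    apply: FreshOrigin ya ab nb _ _ _ => //; exists k.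
    by rewrite run_seq wk extend_eq.
  by rewrite (run_agree miss (@extend_agree y i b)) -(run_agree miss ab).
exact: (IH ((i, j) :: w)).
Qed.

(** Two origins of one sequence coincide: the newest value of each occurs in the
    other, so that two different ones would be older than each other. Hence both
    labels come from the same point by words of copies that agree on the original
    sequence, and [run_equal_at] applies. *)
Lemma label_unique y a b : #|I| != 0 -> label y a -> label y b -> a = b.
Proof.
move=> I0 /label_origin oa /label_origin ob.
have k : I by case: (pickP I) => // I_0; rewrite eq_card0 in I0.
case: oa => [a0 w ey ->|y0 a0 i a1 w y0a aa1 na ey -> [ka eka]].
  case: ob => [a0' w' ey' ->|y0' a0' i' a1' w' _ _ _ _ _ [kb]]; last first.
    by rewrite ey run_seq.
  have e l : base_seq a0 (wmap w l) = base_seq a0' (wmap w' l).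
    by rewrite -!run_seq -ey -ey'.
  case: (e k) => ea _; subst a0'.
  by apply: run_equal_at => l; apply/base_seq_eq.
case: ob => [a0' w' ey' ->|y0' a0' i' a1' w' y0b ab1 nb ey' -> [kb ekb]].
  by move: eka; rewrite ey' run_seq.
have here y1 i1 b1 y2 i2 b2 w2 l : run w2 (extend y1 i1 b1) l = Fresh y2 i2 b2 ->
    Fresh y1 i1 b1 = Fresh y2 i2 b2 \/ occurs_in (Fresh y2 i2 b2) (Fresh y1 i1 b1).
  rewrite run_seq; have [->|ne] := eqVneq (wmap w2 l) i1.
    by rewrite extend_eq; left.
  by rewrite extend_neq // => <-; right; exists y1, i1, b1, (wmap w2 l).
move: ekb; rewrite ey => /here[eF|F1].
  case: eF => ? ? ?; subst y0' i' a1'.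
  apply: run_equal_at => l; apply/(label_equal_at _ _ (label_extend y0a aa1 na)).
  by rewrite -!run_seq -ey -ey'.
move: eka; rewrite ey' => /here[eF|F2]; last by have := occurs_in_asym F1 F2.
by rewrite eF in F1; have := occurs_in_asym F1 F1.
Qed.

Lemma exists_other i : 1 < #|I| -> exists j, j != i.
Proof.
rewrite (cardD1 i) inE ltnS => /card_gt0P[j].
by rewrite !inE; case: (eqVneq j i) => // ji _; exists j.
Qed.

(** Copying over the i-th term turns both sequences into the same one, whose label
    is unique. *)
Lemma label_agree y a i u b : 1 < #|I| ->
  label y a -> label [eta y with i |-> u] b -> agree_off i a b.
Proof.
move=> I2 ya yb.
have [j ji] := exists_other i I2.
apply: (agree_off_one ji); apply: (@label_unique y.{i := j}).
- by case: #|I| I2.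
- exact: label_copy.
suff -> : (y : seqs).{i := j} = ([eta y with i |-> u] : seqs).{i := j} by exact: label_copy.
apply/funext => k; rewrite !seq_systemE /= /redirect.
by case: (eqVneq k i) => [_|/negbTE ->//]; rewrite (negbTE ji).
Qed.

Lemma label_step y a i b : label y a -> agree_off i a b ->
  exists u, label [eta y with i |-> u] b.
Proof.
move=> ya ab.
have [/existsP[j /andP[ji /asboolP ij]]|/existsPn nij] :=
  boolP [exists j, (j != i) && `[<equal_at b i j>]].
  exists (y j); rewrite -ij -ab //; exact: label_copy.
exists (Fresh y i b); apply: label_extend ya ab _ => j ji ij.
by move: (nij j); rewrite ji /=; move/asboolPn.
Qed.

End Unravelling.

(** * Cylindrifications, diagonals and substitutions in the algebra *)

Section AlgebraTheory.
Variables (I : finType) (A : algebra I) (hA : PTA A).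
Implicit Types (i j k l m : I) (x y z : A).

Local Open Scope alg_scope.

Let bA := pta_boolean hA.
Let cA i := pta_closure hA i.

Lemma mul_idem x : x * x = x.
Proof. by rewrite -{2}(add_absorb bA x x) (mul_absorb bA). Qed.

Lemma le_refl x : x <= x. Proof. exact: mul_idem. Qed.

Lemma le_trans y x z : x <= y -> y <= z -> x <= z.
Proof. by rewrite /le => <- h; rewrite -(mul_assoc bA) h. Qed.

Lemma le_anti x y : x <= y -> y <= x -> x = y.
Proof. by rewrite /le => h1 h2; rewrite -h1 (mul_comm bA). Qed.

Lemma le_mull x y : x * y <= x.
Proof. by rewrite /le (mul_comm bA) (mul_assoc bA) mul_idem. Qed.

Lemma le_mulr x y : x * y <= y.
Proof. by rewrite /le -(mul_assoc bA) mul_idem. Qed.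

Lemma le_glb z x y : z <= x -> z <= y -> z <= x * y.
Proof. by rewrite /le => h1 h2; rewrite (mul_assoc bA) h1 h2. Qed.

Lemma le_mul x y z t : x <= y -> z <= t -> x * z <= y * t.
Proof.
move=> h1 h2; apply: le_glb.
  exact: le_trans (le_mull _ _) h1.
exact: le_trans (le_mulr _ _) h2.
Qed.

Lemma le_addl x y : x <= x + y. Proof. exact: mul_absorb. Qed.

Lemma le_addr x y : y <= x + y.
Proof. by rewrite (add_comm bA); exact: le_addl. Qed.

Lemma le_lub z x y : x <= z -> y <= z -> x + y <= z.
Proof. by rewrite /le (mul_add_distr bA) => -> ->. Qed.

Lemma mulx1 x : x * 1 = x.
Proof. by rewrite (mul_comm bA) (mul_one bA). Qed.

Lemma addx0 x : x + 0 = x.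
Proof. by rewrite (add_comm bA) (add_zero bA). Qed.

Lemma le_one x : x <= 1. Proof. exact: mulx1. Qed.

Lemma mulx0 x : x * 0 = 0.
Proof. by rewrite -(mul_opp bA x) (mul_assoc bA) mul_idem. Qed.

Lemma le_zero x : 0 <= x. Proof. by rewrite /le (mul_comm bA) mulx0. Qed.

Lemma mul_addr x y z : x * (y + z) = x * y + x * z.
Proof. by rewrite !(mul_comm bA x) (mul_add_distr bA). Qed.

Lemma le_of_mul_opp x y : x * - y = 0 -> x <= y.
Proof. by move=> h; rewrite /le -{2}[x]mulx1 -(add_opp bA y) mul_addr h addx0. Qed.

Lemma opp_unique x y : x + y = 1 -> x * y = 0 -> y = - x.
Proof.
move=> h1 h0; apply: le_anti.
  by rewrite /le -{2}[y]mulx1 -(add_opp bA x) mul_addr (mul_comm bA y x) h0 (add_zero bA).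
by rewrite /le -{2}[- x]mulx1 -h1 mul_addr (mul_comm bA _ x) (mul_opp bA) (add_zero bA).
Qed.

Lemma opp_one : opp 1 = 0 :> A.
Proof. by rewrite -(mul_opp bA 1%A) (mul_one bA). Qed.

Lemma cyl_ext i x : x <= cyl i x. Proof. exact: closure_ext. Qed.

Lemma cyl_mono i x y : x <= y -> cyl i x <= cyl i y.
Proof. exact: closure_mono. Qed.

Lemma cyl_idem i x : cyl i (cyl i x) = cyl i x. Proof. exact: closure_idem. Qed.

Lemma cyl_one i : cyl i 1 = 1 :> A.
Proof. by apply: le_anti (le_one _) (cyl_ext _ _). Qed.

Lemma cyl_zero i : cyl i 0 = 0 :> A.
Proof. by rewrite -opp_one (pta_compl hA (cyl_one i)). Qed.

(** Complements of closed elements are closed, so x can be split along y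
    before closing. *)
Lemma cyl_mul_closed i x y : cyl i y = y -> cyl i (x * y) = cyl i x * y.
Proof.
move=> cy; apply: le_anti.
  apply: le_glb; first exact/cyl_mono/le_mull.
  by rewrite -{2}cy; exact/cyl_mono/le_mulr.
have cny := pta_compl hA cy.
have h : cyl i x <= cyl i (x * y) + - y.
  have -> : cyl i (x * y) + - y = cyl i (cyl i (x * y) + - y).
    by rewrite (closure_add (cA i)) cyl_idem cny.
  apply: cyl_mono; rewrite -{1}[x]mulx1 -(add_opp bA y) mul_addr.
  apply: le_lub; first exact: le_trans (cyl_ext i _) (le_addl _ _).
  exact: le_trans (le_mulr _ _) (le_addr _ _).
apply: le_trans (le_mul h (le_refl y)) _.
rewrite (mul_add_distr bA) (mul_comm bA (- y)) (mul_opp bA) addx0.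
exact: le_mull.
Qed.

Lemma cyl_closed_mul i x y : cyl i y = y -> cyl i (y * x) = y * cyl i x.
Proof. by move=> cy; rewrite !(mul_comm bA y); exact: cyl_mul_closed. Qed.

Lemma diag_id i : diag i i = 1 :> A. Proof. exact: pta_C5. Qed.

Lemma cyl_diag i j : i != j -> cyl i (diag i j) = 1 :> A.
Proof.
move=> ij; apply: le_anti (le_one _) _.
rewrite -(diag_id j) (@pta_C6 _ _ hA j j i); last by rewrite !inE (negbTE ij).
by apply: cyl_mono; exact: le_mulr.
Qed.

Lemma diag_sym i j : diag i j = diag j i :> A.
Proof.
have [->//|ij] := eqVneq i j.
suff h k l : k != l -> diag k l <= (diag l k : A).
  by apply: le_anti; apply: h; rewrite // eq_sym.
move=> kl; have := pta_C7 hA (diag l k) kl.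
rewrite (mul_comm bA (diag k l) (diag l k)).
by rewrite -(@pta_C6 _ _ hA l l k) ?diag_id ?mulx1 // !inE (negbTE kl).
Qed.

Lemma diag_trans i j k : diag i j * diag j k <= (diag i k : A).
Proof.
have [->|ij] := eqVneq i j; first exact: le_mulr.
have [->|jk] := eqVneq j k; first exact: le_mull.
rewrite (@pta_C6 _ _ hA i k j); first exact: cyl_ext.
by rewrite !inE eq_sym (negbTE ij) (negbTE jk).
Qed.

Lemma diag_mul_diag i j k : diag j k * diag i j = diag j k * diag i k :> A.
Proof.
apply: le_anti; apply: le_glb; try exact: le_mull.
  by rewrite (mul_comm bA); exact: diag_trans.
by rewrite (mul_comm bA) (diag_sym j); exact: diag_trans.
Qed.

Lemma cyl_diag_other i j k : k != i -> k != j -> cyl k (diag i j) = diag i j :> A.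
Proof.
move=> ki kj; have [->|ij] := eqVneq i j; first by rewrite diag_id cyl_one.
by rewrite (@pta_C6 _ _ hA i j k) ?cyl_idem // !inE (negbTE ki).
Qed.

Lemma sub_id i x : sub i i x = x. Proof. by rewrite /sub eqxx. Qed.

Lemma subE i j x : i != j -> sub i j x = cyl i (diag i j * x).
Proof. by rewrite /sub => /negbTE ->. Qed.

Lemma cyl_sub i j x : i != j -> cyl i (sub i j x) = sub i j x.
Proof. by move=> ij; rewrite subE // cyl_idem. Qed.

Lemma sub_closed i j x : cyl i x = x -> sub i j x = x.
Proof.
move=> cx; have [->|ij] := eqVneq i j; first exact: sub_id.
by rewrite subE // cyl_mul_closed // cyl_diag // (mul_one bA).
Qed.

Lemma sub_mono i j x y : x <= y -> sub i j x <= sub i j y.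
Proof.
move=> xy; have [->|ij] := eqVneq i j; first by rewrite !sub_id.
by rewrite !subE //; apply/cyl_mono/le_mul; first exact: le_refl.
Qed.

Lemma diag_sub i j x : i != j -> diag i j * sub i j x = diag i j * x.
Proof.
move=> ij; rewrite subE //; apply: le_anti; apply: le_glb; try exact: le_mull.
  exact: pta_C7.
exact: cyl_ext.
Qed.

Lemma sub_mul i j x y : sub i j (x * y) = sub i j x * sub i j y.
Proof.
have [->|ij] := eqVneq i j; first by rewrite !sub_id.
apply: le_anti; first by apply: le_glb; apply: sub_mono; [exact: le_mull|exact: le_mulr].
rewrite {1}subE // -cyl_mul_closed ?cyl_sub // [in X in _ <= X]subE //.
apply: cyl_mono; rewrite (mul_comm bA _ x) -(mul_assoc bA) diag_sub //.
rewrite !(mul_assoc bA) (mul_comm bA x); exact: le_refl.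
Qed.

Lemma sub_one i j : sub i j 1 = 1 :> A.
Proof. exact/sub_closed/cyl_one. Qed.

Lemma sub_opp i j x : sub i j (- x) = - sub i j x.
Proof.
have [->|ij] := eqVneq i j; first by rewrite !sub_id.
apply: opp_unique; last first.
  by rewrite -sub_mul (mul_opp bA); apply/sub_closed/cyl_zero.
by rewrite !subE // -(closure_add (cA i)) -mul_addr (add_opp bA) mulx1 cyl_diag.
Qed.

Lemma sub_over i j k x : k != i -> sub i j (sub i k x) = sub i k x.
Proof. by move=> ki; apply/sub_closed/cyl_sub; rewrite eq_sym. Qed.

Lemma sub_alias i j k x : sub j k (sub i j x) = sub j k (sub i k x).
Proof.
have [->|jk] := eqVneq j k; first by rewrite !sub_id.
have [->|ij] := eqVneq i j; first by rewrite sub_id sub_over // eq_sym.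
have [->|ik] := eqVneq i k.
  rewrite sub_id !(subE _ jk) (diag_sym j); congr cyl.
  by rewrite diag_sub // eq_sym.
rewrite !(subE _ jk) (subE _ ij) (subE _ ik); congr cyl.
have cd : cyl i (diag j k) = diag j k :> A by rewrite cyl_diag_other.
by rewrite -!(cyl_closed_mul _ cd) !(mul_assoc bA) diag_mul_diag.
Qed.

(** The only use of the weak commutativity of cylindrifications: the diagonal
    d_ij needed there is available because a substitution s^i_j may always be evaluated
    below d_ij. *)
Lemma sub_comm i j k l x : k != i -> l != i -> j != k ->
  sub i j (sub k l x) = sub k l (sub i j x).
Proof.
wlog suff le : i j k l / k != i -> l != i -> j != k ->
    sub k l (sub i j x) <= sub i j (sub k l x) => [ki li jk|].
  apply: le_anti; last exact: le.
  by apply: le; rewrite // eq_sym.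
move=> ki li jk; have [->|ij] := eqVneq i j; first by rewrite !sub_id; exact: le_refl.
have [->|kl] := eqVneq k l; first by rewrite !sub_id; exact: le_refl.
set t := diag i j * (diag k l * x).
have kd : cyl k (diag i j) = diag i j :> A by rewrite cyl_diag_other // eq_sym.
have id : cyl i (diag k l) = diag k l :> A by rewrite cyl_diag_other // eq_sym.
have -> : sub k l (sub i j x) = cyl k (cyl i t).
  rewrite !subE // -(cyl_closed_mul _ id) /t !(mul_assoc bA).
  by rewrite (mul_comm bA (diag k l)).
have -> : sub i j (sub k l x) = cyl i (cyl k t).
  by rewrite !subE // -(cyl_closed_mul _ kd).
have dt : diag i j * cyl i t <= t.
  have := diag_sub (diag k l * x) ij; rewrite subE // => ->; exact: le_refl.
have step : diag i j * cyl i (cyl k (cyl i t)) <= cyl k t.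
  have C4 : cyl i (cyl k (cyl i t)) * diag i j <= cyl k (cyl i t).
    rewrite -{2}[cyl i t]cyl_idem; apply: (pta_C4 hA).
    by rewrite !inE negb_or jk eq_sym.
  have -> : diag i j * cyl i (cyl k (cyl i t))
      = diag i j * (cyl i (cyl k (cyl i t)) * diag i j).
    by rewrite (mul_comm bA _ (diag i j)) (mul_assoc bA) mul_idem.
  apply: le_trans (le_mul (le_refl _) C4) _.
  by rewrite -(cyl_closed_mul _ kd); apply: cyl_mono.
apply: le_trans (cyl_ext i _) _; rewrite -[X in X <= _]mulx1 -(cyl_diag ij).
rewrite -(cyl_closed_mul _ (cyl_idem i _)) (mul_comm bA).
exact: cyl_mono.
Qed.

End AlgebraTheory.

(** * Ultrafilters *)

Section Ultrafilters.
Variables (I : finType) (A : algebra I) (hA : PTA A).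
Implicit Types (i j k l m : I) (x y z : A) (U F : set A).

Local Open Scope alg_scope.
Local Open Scope classical_set_scope.

Let bA := pta_boolean hA.

Record ultrafilter U : Prop := Ultrafilter {
  ultra_one : U 1;
  ultra_mul : forall x y, U x -> U y -> U (x * y);
  ultra_up : forall x y, x <= y -> U x -> U y;
  ultra_opp : forall x, U (- x) <-> ~ U x
}.

Lemma ultra_zero U : ultrafilter U -> ~ U 0.
Proof.
move=> uU; rewrite -(opp_one hA); apply/(ultra_opp uU); rewrite not_notE.
exact: ultra_one.
Qed.

Definition meet_closed F := forall x y, F x -> F y -> F (x * y).

(** A set maximal among those whose union with [F] is closed under meets and omits
    0. The union with [F] is there because the empty chain has to be admitted. *)
Lemma ultrafilter_exists F : F 1 -> meet_closed F -> ~ F 0 ->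
  exists2 U, ultrafilter U & F `<=` U.
Proof.
move=> F1 FM F0.
pose P (G : set A) := meet_closed (G `|` F) /\ ~ (G `|` F) 0.
have [G GP Gtot|M [[MM M0] Mmax]] := @Zorn_bigcup A P.
  have tot x y : (\bigcup_(X in G) X `|` F) x -> (\bigcup_(X in G) X `|` F) y ->
      (F x /\ F y) \/ exists2 X, G X & (X `|` F) x /\ (X `|` F) y.
    move=> [[X GX Xx]|Fx] [[Y GY Yy]|Fy]; last by left.
    - by right; have [XY|YX] := Gtot _ _ GX GY; [exists Y|exists X] => //;
        split; left => //; [exact: XY|exact: YX].
    - by right; exists X => //; split; [left|right].
    - by right; exists Y => //; split; [right|left].
  split=> [x y hx hy|].
    have [[Fx Fy]|[X GX [Xx Xy]]] := tot x y hx hy; first by right; exact: FM.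
    by have [/(_ _ _ Xx Xy)[h|h] _] := GP X GX; [left; exists X|right].
  by move=> [[X GX X0]|//]; have [_] := GP X GX; apply; left.
pose U := M `|` F.
have U1 : U 1 by right.
(* By maximality, U contains every element that meets all its members. *)
have meets_all x : (forall y, U y -> y * x <> 0) -> U x.
  move=> hx; apply: contrapT => Ux.
  apply: (Mmax (M `|` [set z | exists2 y, U y & z = y * x])).
    split=> [z Mz|]; first by left.
    move=> /(_ x) h; apply: Ux; left; apply: h; right; exists 1 => //.
    by rewrite (mul_one bA).
  split=> [y z|[[M_0|[y Uy /esym]]|]]; first last.
  - exact: F0.
  - exact: hx.
  - by apply: M0; left.
    have E t : (M `|` [set z | exists2 y, U y & z = y * x] `|` F) t <->
        U t \/ exists2 y, U y & t = y * x.
      by rewrite /U /setU /=; tauto.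
    rewrite !E => -[Uy|[y' Uy ->]] [Uz|[z' Uz ->]].
    - by left; exact: MM.
    - by right; exists (y * z'); [exact: MM|rewrite (mul_assoc bA)].
    - right; exists (y' * z); first exact: MM.
      by rewrite -!(mul_assoc bA) (mul_comm bA x).
    - right; exists (y' * z'); first exact: MM.
      rewrite -!(mul_assoc bA) (mul_comm bA x) -(mul_assoc bA).
      by rewrite (mul_idem hA).
have UM x y : U x -> U y -> U (x * y) by exact: MM.
have oppU x : U (- x) <-> ~ U x.
  split=> [Unx Ux|nUx]; first by apply: M0; rewrite -(mul_opp bA x); exact: UM.
  apply: (meets_all) => y Uy y0; apply: (nUx (meets_all x _)) => z Uz z0; apply: M0.
  suff -> : 0 = z * y by exact: UM.
  apply: (le_anti hA) (le_zero hA _) _; rewrite -z0.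
  by apply: (le_mul hA (le_refl hA _)); exact: (le_of_mul_opp hA).
exists U => [|x Fx]; last by right.
split=> // x y xy Ux; apply: contrapT => /oppU Uny; apply: M0.
have -> : 0 = x * - y; last exact: UM.
by rewrite -xy -(mul_assoc bA) (mul_opp bA) (mulx0 hA).
Qed.

Lemma ultrafilter_separates x y : ~ (x <= y) ->
  exists2 U, ultrafilter U & U x /\ ~ U y.
Proof.
move=> xy; have [||| U uU FU] := @ultrafilter_exists [set z | x * - y <= z].
- exact: (le_one hA).
- by move=> z t /= hz ht; exact: (le_glb hA).
- move=> /= h; apply: xy; apply: (le_of_mul_opp hA).
  by apply: (le_anti hA) h _; exact: (le_zero hA).
exists U => //; split; first by apply: FU; exact: (le_mull hA).
by apply/(ultra_opp uU)/FU; exact: (le_mulr hA).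
Qed.

Definition stone := {U : set A | ultrafilter U}.

Lemma stone_eq (a b : stone) : (forall x, sval a x <-> sval b x) -> a = b.
Proof.
case: a b => [U uU] [V uV] /= h; apply: eq_exist.
by apply/predeqP.
Qed.

Lemma stone_sub (a b : stone) : sval a `<=` sval b -> a = b.
Proof.
move=> h; apply: stone_eq => x; split; first exact: h.
have uU := svalP a; have uV := svalP b.
move=> bx; apply: contrapT => /(ultra_opp uU)/h.
by move/(ultra_opp uV).
Qed.

Lemma ultrafilter_pullback i j U : ultrafilter U -> ultrafilter [set x | U (sub i j x)].
Proof.
move=> uU; split=> /= [|x y Ux Uy|x y xy|x].
- by rewrite (sub_one hA); exact: ultra_one.
- by rewrite (sub_mul hA); exact: ultra_mul.
- by apply: ultra_up => //; exact: (sub_mono hA).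
- by rewrite (sub_opp hA); exact: ultra_opp.
Qed.

(** Substitutions are Boolean endomorphisms, hence they act on ultrafilters in
    the opposite direction. *)
Definition stone_copy i j (a : stone) : stone :=
  exist _ _ (ultrafilter_pullback i j (svalP a)).

Lemma stone_copyE i j (a : stone) x :
  sval (stone_copy i j a) x = sval a (sub i j x).
Proof. by []. Qed.

Fact stone_copy_id i a : stone_copy i i a = a.
Proof. by apply: stone_eq => x; rewrite stone_copyE (sub_id). Qed.

Fact stone_copy_over i j k a : k != i ->
  stone_copy i k (stone_copy i j a) = stone_copy i k a.
Proof. by move=> ki; apply: stone_eq => x; rewrite !stone_copyE (sub_over hA). Qed.

Fact stone_copy_comm i j k l a : k != i -> l != i -> j != k ->
  stone_copy k l (stone_copy i j a) = stone_copy i j (stone_copy k l a).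
Proof.
by move=> *; apply: stone_eq => x; rewrite !stone_copyE (sub_comm hA).
Qed.

Lemma stone_copy_fix i j a : stone_copy i j a = a <-> sval a (diag i j).
Proof.
have ua := svalP a; have [->|ij] := eqVneq i j.
  rewrite stone_copy_id (diag_id hA); split=> // _; exact: ultra_one.
split=> [<-|da].
  rewrite stone_copyE (subE _ ij) (mul_idem hA) (cyl_diag hA) //.
  exact: ultra_one.
apply/esym/stone_sub => x ax; rewrite stone_copyE (subE _ ij).
by apply: (ultra_up ua (cyl_ext hA i _)); exact: ultra_mul.
Qed.

Fact stone_copy_reflect i j k l a : k != i -> l != i ->
  stone_copy k l (stone_copy i j a) = stone_copy i j a -> stone_copy k l a = a.
Proof.
move=> ki li /stone_copy_fix; rewrite stone_copyE (sub_closed hA).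
  by move/stone_copy_fix.
by rewrite (cyl_diag_other hA) // eq_sym.
Qed.

Fact stone_copy_alias i j k a :
  stone_copy i j (stone_copy j k a) = stone_copy i k (stone_copy j k a).
Proof. by apply: stone_eq => x; rewrite !stone_copyE (sub_alias hA). Qed.

Fact stone_copy_mgr k i j m l a :
  k \notin [:: i; j; m] -> m \notin [:: i; j] -> l != k ->
  stone_copy k l (stone_copy m k (stone_copy j m (stone_copy i j (stone_copy k i a))))
    = stone_copy k l
        (stone_copy j k (stone_copy i j (stone_copy m i (stone_copy k m a)))).
Proof.
move=> km mi lk; apply: stone_eq => x; rewrite !stone_copyE.
have c : cyl k (sub k l x) = sub k l x by rewrite (cyl_sub hA) // eq_sym.
by rewrite -c (pta_MGR hA).
Qed.

Definition stone_system : subst_system I :=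
  SubstSystem stone_copy_id stone_copy_over stone_copy_comm stone_copy_reflect
    stone_copy_alias stone_copy_mgr.

(** The ultrafilter b has to contain x and all the c_i-closed elements of a; these
    are compatible with x because c_i (x * y) = c_i x * y for closed y. *)
Lemma stone_cyl i x (a : stone_system) : (1 < #|I|)%N ->
  sval a (cyl i x) <-> exists2 b : stone_system, agree_off i a b & sval b x.
Proof.
move=> I2; have ua := svalP a; split=> [acx|[b ab bx]]; last first.
  have [j ji] := exists_other i I2.
  have E : sval a (sub i j (cyl i x)) <-> sval b (sub i j (cyl i x)).
    by have := congr1 (fun c : stone => sval c (cyl i x)) (ab j ji) => /= ->.
  move: E; rewrite (sub_closed hA _ (cyl_idem hA _ _)) => ->.
  by apply: (ultra_up (svalP b) (cyl_ext hA i _)).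
pose F := [set z | exists2 y, sval a y /\ cyl i y = y & x * y <= z].
have [||| U uU FU] := @ultrafilter_exists F.
- exists 1%A; last exact: (le_one hA).
  by split; [exact: ultra_one|exact: (cyl_one hA)].
- move=> z t [y [ay cy] yz] [u [au cu] ut]; exists (y * u)%A.
    split; first exact: ultra_mul.
    by rewrite (cyl_mul_closed hA) // cy.
  apply: (le_trans hA) (le_mul hA yz ut).
  apply: (le_glb hA); apply: (le_mul hA (le_refl hA _)).
    exact: (le_mull hA).
  exact: (le_mulr hA).
- move=> [y [ay cy] xy0].
  have : sval a (cyl i (x * y)%A).
    by rewrite (cyl_mul_closed hA) //; exact: ultra_mul.
  have -> : (x * y)%A = 0%A by apply: (le_anti hA) xy0 (le_zero hA _).
  by rewrite (cyl_zero hA) => /(ultra_zero ua).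
exists (exist _ U uU : stone); last first.
  apply: FU; exists 1%A; last exact: (le_mull hA).
  by split; [exact: ultra_one|exact: (cyl_one hA)].
move=> j ji; apply: stone_sub => y ay; apply: FU; exists (sub i j y).
  by split=> //; rewrite (cyl_sub hA) // eq_sym.
exact: (le_mulr hA).
Qed.

End Ultrafilters.

(** * The representation *)

Section Representation.
Variables (I : finType) (A : algebra I) (hA : PTA A).
Hypothesis I2 : (1 < #|I|)%N.
Implicit Types (i j k : I) (x y : A).

Local Open Scope classical_set_scope.

Let bA := pta_boolean hA.
Let S := stone_system hA.

Implicit Types (a b : S) (s : I -> vertex S).

Let I0 : #|I| != 0%N. Proof. by case: #|I| I2. Qed.

Definition labelled : set (I -> vertex S) := [set s | exists a, label s a].

Definition rep x : set (I -> vertex S) :=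
  [set s | exists2 a : S, label s a & sval a x].

Lemma rep_label s a x : label s a -> rep x s <-> sval a x.
Proof.
move=> sa; split=> [[b sb bx]|ax]; last by exists a.
by rewrite (label_unique I0 sa sb).
Qed.

Lemma rep_sub x : rep x `<=` labelled.
Proof. by move=> s [a sa _]; exists a. Qed.

Lemma rep_ext (X : set (I -> vertex S)) x : X `<=` labelled ->
  (forall s a, label s a -> X s <-> sval a x) -> X = rep x.
Proof.
move=> Xsub h; apply/predeqP => s; split=> [Xs|[a sa ax]].
  by have [a sa] := Xsub _ Xs; exists a => //; apply/(h s a).
by apply/(h s a).
Qed.

Lemma rep_zero : set0 = rep 0%A.
Proof.
apply: rep_ext => [s []|s a sa]; split=> [[]|].
by move/(ultra_zero hA (svalP a)).
Qed.

Lemma rep_one : labelled = rep 1%A.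
Proof.
apply: rep_ext => // s a sa; split=> _; last by exists a.
exact: ultra_one (svalP a).
Qed.

Lemma rep_mul x y : rep x `&` rep y = rep (x * y)%A.
Proof.
apply: rep_ext => [s [/rep_sub]//|s a sa]; have ua := svalP a.
rewrite /setI /= !(rep_label _ sa); split=> [[]|axy]; first exact: ultra_mul.
by split; apply: ultra_up axy => //; [exact: (le_mull hA)|exact: (le_mulr hA)].
Qed.

Lemma rep_opp x : labelled `\` rep x = rep (- x)%A.
Proof.
apply: rep_ext => [s []//|s a sa]; have ua := svalP a.
rewrite /setD /= (rep_label _ sa) (ultra_opp ua).
by split=> [[]|] //; split=> //; exists a.
Qed.

Lemma rep_add x y : rep x `|` rep y = rep (x + y)%A.
Proof.
apply: rep_ext => [s [/rep_sub|/rep_sub]//|s a sa]; have ua := svalP a.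
rewrite /setU /= !(rep_label _ sa); split=> [[ax|ay]|axy].
- exact: (ultra_up ua (le_addl hA _ _)).
- exact: (ultra_up ua (le_addr hA _ _)).
apply: contrapT => /not_orP[/(ultra_opp ua) nx /(ultra_opp ua) ny].
apply: (ultra_zero hA ua); have := ultra_mul ua axy (ultra_mul ua nx ny).
rewrite (mul_add_distr bA) [in X in (_ + X)%A](mul_comm bA (- x)%A).
by rewrite !(mul_assoc bA) !(mul_opp bA) !(mul_comm bA 0%A) !(mulx0 hA) (add_zero bA).
Qed.

Lemma rep_cyl i x : cylset labelled i (rep x) = rep (cyl i x).
Proof.
apply: rep_ext => [s []//|s a sa]; rewrite (stone_cyl _ _ _ I2); split.
  move=> [_ [u [b sb bx]]]; exists b => //; exact: (label_agree I2 sa sb).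
move=> [b ab bx]; split; first by exists a.
by have [u sb] := label_step sa ab; exists u, b.
Qed.

Lemma rep_diag i j : diagset labelled i j = rep (diag i j).
Proof.
apply: rep_ext => [s []//|s a sa].
rewrite -(stone_copy_fix hA) -/(equal_at (S := S) a i j).
rewrite -(label_equal_at _ _ sa) /diagset /=.
by split=> [[]|] //; split=> //; exists a.
Qed.

Definition range_rep : set (set (I -> vertex S)) := [set X | exists x, X = rep x].

Definition rep_algebra : set_algebra I.
Proof.
apply: (@SetAlgebra I (vertex S) labelled range_rep).
- by move=> X [x ->]; exact: rep_sub.
- by exists 0%A; exact: rep_zero.
- by exists 1%A; exact: rep_one.
- by move=> X Y [x ->] [y ->]; exists (x + y)%A; exact: rep_add.
- by move=> X Y [x ->] [y ->]; exists (x * y)%A; exact: rep_mul.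
- by move=> X [x ->]; exists (- x)%A; exact: rep_opp.
- by move=> i X [x ->]; exists (cyl i x); exact: rep_cyl.
- by move=> i j; exists (diag i j); exact: rep_diag.
Defined.

Definition rep_hom x : algebra_of rep_algebra :=
  exist _ (rep x) (ex_intro (fun z => rep x = rep z) x erefl).

Lemma rep_hom_eq x (X : algebra_of rep_algebra) : sval X = rep x -> rep_hom x = X.
Proof. by case: X => X hX /= e; apply: eq_exist. Qed.

Lemma rep_inj : injective rep.
Proof.
suff le x y : rep x = rep y -> (x <= y)%A.
  by move=> x y e; apply: (le_anti hA); apply: le.
move=> e; apply: contrapT => /(ultrafilter_separates hA)[U uU [Ux Uy]].
pose a : S := exist _ U uU; apply: Uy.
apply/(rep_label y (label_base a)); rewrite -e.
exact/(rep_label x (label_base a)).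
Qed.

Lemma rep_hom_hom : homomorphism rep_hom.
Proof.
split=> *; apply: rep_hom_eq => /=.
- exact: rep_add.
- exact: rep_mul.
- exact: rep_opp.
- exact: rep_zero.
- exact: rep_one.
- exact: rep_cyl.
- exact: rep_diag.
Qed.

Lemma rep_hom_bij : bijective rep_hom.
Proof.
have surj (X : algebra_of rep_algebra) : exists x, sval X = rep x by case: X.
pose g X := sval (cid (surj X)).
have gK X : sval X = rep (g X) by exact: svalP (cid (surj X)).
exists g => [x|X]; last exact: rep_hom_eq.
by apply: rep_inj; rewrite -gK.
Qed.

(** The unit is closed under copies, which is what membership in D asks for. *)
Lemma labelled_copy i j :
  cylset labelled i (diagset labelled i j `&` labelled) = labelled.
Proof.
apply/predeqP => s; split=> [[]//|ls]; split=> //; exists (s j).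
have [a sa] := ls; have l : labelled [eta s with i |-> s j].
  by exists (copy i j a); exact: label_copy.
split=> //; split=> //=; rewrite eqxx.
by case: eqP => // ->.
Qed.

Theorem PTA_representable : iso_closure (@D I) A.
Proof.
exists (algebra_of rep_algebra); split.
  by exists rep_algebra; split=> // i j; exact: labelled_copy.
by exists rep_hom; split; [exact: rep_hom_hom|exact: rep_hom_bij].
Qed.

End Representation.

Theorem theorem3p1 (n : nat) (hn : 2 <= n) (A : algebra 'I_n) (hA : PTA A) :
  iso_closure (@D 'I_n) A.
Proof. by apply: PTA_representable hA _; rewrite card_ord. Qed.
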